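(* Let $0<\alpha<1$, let $v\in S(\mathbb{R})$ and put $u:=r_+v$. Then there is a function $m:[0,\infty)\to\mathbb{R}$, which is $O(|w|^{-1-2\alpha})$ for small $|w|$ and $O(e^{-|w|})$ as $|w|\to\infty$, such that for every $x>0$ $$(\mathcal{A}u)(x)=u(x)+\lim_{\epsilon\searrow 0}\int_0^\infty (u(x)-u(y))\,\chi_\epsilon(|x-y|)\,m(|x-y|)\,dy,$$ and moreover $$(\mathcal{A}u,u)=\int_0^\infty|u(x)|^2\,dx+\tfrac12\int_0^\infty\!\!\int_0^\infty|u(x)-u(y)|^2\,m(|x-y|)\,dy\,dx .$$
   Context: $S(\mathbb{R})$ is the Schwartz space and $S'(\mathbb{R})$ the tempered distributions. The Fourier transform is $(\mathcal{F}u)(\xi)=(2\pi)^{-1/2}\int_{\mathbb{R}}e^{i\xi x}u(x)\,dx$, extended to $S'(\mathbb{R})$. $A$ is the pseudodifferential operator $A=\mathcal{F}^{-1}(1+\xi^2)^{\alpha}\mathcal{F}$. $r_+$ denotes restriction from $\mathbb{R}$ to $\mathbb{R}_+=(0,\infty)$, $e_+$ extension by zero from $\mathbb{R}_+$ to $\mathbb{R}$, and $\chi_{\mathbb{R}_-}$ the characteristic function of $(-\infty,0)$. The operator $\mathcal{A}$ is defined by $\mathcal{A}u:=r_+Ae_+u+u\cdot r_+A(\chi_{\mathbb{R}_-})$. For $\epsilon>0$, $\chi_\epsilon$ is the characteristic function of $(\epsilon,\infty)$. $(f,g)=\int_0^\infty f(x)\overline{g(x)}\,dx$. *)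

(* Defs.v *)
From HB Require Import structures.
From mathcomp Require Import all_boot all_order all_algebra.
From mathcomp Require Import all_classical all_reals all_analysis.
From mathcomp Require Import complex.
Set Implicit Arguments. Unset Strict Implicit. Unset Printing Implicit Defensive.
Import Order.TTheory GRing.Theory Num.Theory.
Import numFieldNormedType.Exports.
Local Open Scope classical_set_scope.
Local Open Scope ring_scope.

Section Defs.
Variable R : realType.
Local Notation C := (complex R).
Local Notation mu := (@lebesgue_measure R).

Definition cre (z : C) : R := complex.Re z.
Definition cim (z : C) : R := complex.Im z.
Definition cmk (a b : R) : C := complex.Complex a b.
Definition cofR (a : R) : C := complex.Complex a 0.
Definition cconj (z : C) : C := complex.Complex (cre z) (- cim z).
Definition csqnorm (z : C) : R := cre z ^+ 2 + cim z ^+ 2.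

Definition Cint (D : set R) (f : R -> C) : C :=
  cmk (Rintegral mu D (fun x => cre (f x))) (Rintegral mu D (fun x => cim (f x))).
Definition Cintegrable (D : set R) (f : R -> C) : Prop :=
  mu.-integrable D (fun x => (cre (f x))%:E) /\
  mu.-integrable D (fun x => (cim (f x))%:E).

Definition smoothR (g : R -> R) : Prop := forall (n : nat) (x : R), derivable (derive1n n g) x 1.
Definition schwartzR (g : R -> R) : Prop :=
  smoothR g /\ forall k n : nat, exists M : R, forall x : R, `| x ^+ k * (derive1n n g) x | <= M.
Definition schwartz (v : R -> C) : Prop :=
  schwartzR (fun x => cre (v x)) /\ schwartzR (fun x => cim (v x)).
Definition test_pos (phi : R -> C) : Prop :=
  smoothR (fun x => cre (phi x)) /\ smoothR (fun x => cim (phi x)) /\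
  exists a b : R, 0 < a /\ forall x, (x < a \/ b < x) -> phi x = 0.

Definition cexpi (t : R) : C := cmk (cos t) (sin t).
Definition fourier (u : R -> C) (xi : R) : C :=
  cofR (Num.sqrt (2 * pi))^-1 * Cint setT (fun x => cexpi (xi * x) * u x).
Definition fourier_inv (g : R -> C) (x : R) : C :=
  cofR (Num.sqrt (2 * pi))^-1 * Cint setT (fun xi => cexpi (- (xi * x)) * g xi).
Definition symb (alpha : R) (xi : R) : R := powR (1 + xi ^+ 2) alpha.
(* transpose of A = F^{-1} (1+xi^2)^alpha F acting on test functions; the action of
   A on a tempered distribution T is <A T, phi> = <T, A^t phi>,
   A^t = F (1+xi^2)^alpha F^{-1} (extension of F to S' by <F T, phi> = <T, F phi>) *)
Definition Atrans (alpha : R) (phi : R -> C) : R -> C :=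
  fourier (fun xi => cofR (symb alpha xi) * fourier_inv phi xi).

(* g represents the restriction r_+ (A f) on (0,oo) of the tempered distribution A f
   (f a bounded locally integrable function): g is continuous on (0,oo) and
   <A f, phi> = int_0^oo g phi for all test functions phi supported in (0,oo). *)
Definition rplusA (alpha : R) (f g : R -> C) : Prop :=
  (forall x : R, 0 < x ->
     {for x, continuous (fun t => cre (g t))} /\ {for x, continuous (fun t => cim (g t))}) /\
  forall phi : R -> C, test_pos phi ->
    Cint `]0, +oo[ (fun x => g x * phi x) = Cint setT (fun x => f x * Atrans alpha phi x).

Definition eplus (v : R -> C) (x : R) : C := if 0 < x then v x else 0.
Definition chi_neg (x : R) : C := if x < 0 then 1 else 0.
Definition chi_eps (eps : R) (w : R) : R := if eps < w then 1 else 0.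

End Defs.

(* Main.v *)
Require Import Defs.
From HB Require Import structures.
From mathcomp Require Import all_boot all_order all_algebra.
From mathcomp Require Import all_classical all_reals all_analysis.
From mathcomp Require Import measurable_realfun complex ring lra.
Import Order.TTheory GRing.Theory Num.Def Num.Theory.
Import numFieldNormedType.Exports.
Local Open Scope classical_set_scope.
Local Open Scope ring_scope.
Set Implicit Arguments. Unset Strict Implicit. Unset Printing Implicit Defensive.

(** For lambda = 1 + xi^2, the substitution r -> lambda r in the integral
    B = int_0^oo r^(alpha-1) / (1 + r) dr gives
      lambda^alpha - 1 = B^-1 int_0^oo r^alpha (1/(1+r) - 1/(lambda+r)) dr.
    Since int_0^oo 2 (1 - cos (xi w)) e^(-s w) dw = 2 xi^2 / (s (s^2 + xi^2)), taking
    s = sqrt (1 + r) turns this into the Levy-Khintchine formula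
      (1 + xi^2)^alpha = 1 + int_0^oo 2 (1 - cos (xi w)) m(w) dw
    with m(w) = B^-1 int_0^oo r^alpha e^(-w sqrt (1+r)) / (2 sqrt (1+r)) dr.
    Both bounds on m can be read off this formula, and w^2 m(w) is integrable.
    Fourier inversion, proved by Abel summation with the Poisson kernel, shows that A is
      (A f)(x) = f(x) + int_0^oo (2 f(x) - f(x+w) - f(x-w)) m(w) dw
    on test functions. Transposing it onto e_+ v and chi_- only uses translation
    invariance and Fubini, the second differences being O(w^2) away from 0. For x > 0
    the sum of the two contributions is the principal value, and integrating it against
    conj v and shifting one half of the integral by w symmetrises it to the double
    integral of |v(x) - v(y)|^2 m(|x-y|). *)

(** * Lebesgue integrals on the line *)

(** The bound of order w^(-1-2 alpha) on m does not make w m(w) integrable near 0 when alpha >= 1/2;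
    only w^2 m(w) is available. Hence x + w and x - w must stay paired under the w-integral, and the
    two first differences are separated only after Fubini has fixed w. The second obstacle is the
    jump of e_+ v at 0: its second difference at x is O(w^2) only with a constant depending on the
    distance from x to 0. In the duality this is harmless, test functions being supported in some
    [a, b] with a > 0, but the quadratic form needs a separate estimate on the region w >= x. The
    term with chi_- has a precise task: for w > x > 0 the cut function contributes 2 v(x) - v(x+w),
    and the second difference of chi_- is -1 there, so v(x) times it removes the surplus v(x) and
    only differences v(x) - v(y) with y > 0 remain. Kernel integrals are written in u = ln r, where
    dilations become translations and integrability at r = 0 and r = oo becomes exponential decay at
    both ends of the line. The symbol is real and even, so A preserves real functions and real and
    imaginary parts are treated separately. *)

Section Integrals.
Variable R : realType.
Local Notation mu := (@lebesgue_measure R).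
Implicit Types (f g h : R -> R) (F G : R -> R -> R).

Definition itg (f : R -> R) : Prop := mu.-integrable setT (EFin \o f).
Definition integ (f : R -> R) : R := Rintegral mu setT f.

Lemma itg_mf f : itg f -> measurable_fun setT f.
Proof. by move=> /measurable_int/measurable_EFinP. Qed.

Lemma itg_eq f g : f =1 g -> itg f -> itg g.
Proof. by move=> /funext ->. Qed.

Lemma integ_eq f g : f =1 g -> integ f = integ g.
Proof. by move=> /funext ->. Qed.

Lemma itg_le g f : measurable_fun setT f -> (forall x, `|f x| <= g x) ->
  itg g -> itg f.
Proof.
move=> mf fg; apply: le_integrable => //; first exact/measurable_EFinP.
by move=> x _ /=; rewrite lee_fin (le_trans (fg x))// ler_norm.
Qed.

Lemma itgD f g : itg f -> itg g -> itg (fun x => f x + g x).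
Proof. by move=> fi gi; exact: integrableD fi gi. Qed.

Lemma itgB f g : itg f -> itg g -> itg (fun x => f x - g x).
Proof. by move=> fi gi; exact: integrableB fi gi. Qed.

Lemma itgZ k f : itg f -> itg (fun x => k * f x).
Proof. by move=> fi; exact: (integrableZl _ k fi). Qed.

Lemma itgM_bounded f g M : measurable_fun setT f -> (forall x, `|f x| <= M) ->
  itg g -> itg (fun x => f x * g x).
Proof.
move=> mf fM gi; apply: (@itg_le (fun x => M * `|g x|)).
- by apply: measurable_funM => //; exact: itg_mf.
- by move=> x; rewrite normrM ler_wpM2r.
- by apply: itgZ; exact: (integrable_abse gi).
Qed.

Lemma integD f g : itg f -> itg g ->
  integ (fun x => f x + g x) = integ f + integ g.
Proof. by move=> fi gi; rewrite /integ RintegralD. Qed.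

Lemma integB f g : itg f -> itg g ->
  integ (fun x => f x - g x) = integ f - integ g.
Proof. by move=> fi gi; rewrite /integ RintegralB. Qed.

Lemma integZ k f : itg f -> integ (fun x => k * f x) = k * integ f.
Proof. by move=> fi; rewrite /integ RintegralZl. Qed.

Lemma integ0 : integ (fun=> 0) = 0.
Proof. by rewrite /integ /Rintegral integral0. Qed.

Lemma le_norm_integ f g : itg f -> itg g -> (forall x, `|f x| <= g x) ->
  `|integ f| <= integ g.
Proof.
move=> fi gi fg; apply: (le_trans (le_normr_Rintegral _ _)) => //.
by apply: le_Rintegral => //; exact: (integrable_abse fi).
Qed.

Lemma le_integ f g : itg f -> itg g -> (forall x, f x <= g x) ->
  integ f <= integ g.
Proof. by move=> fi gi fg; apply: le_Rintegral. Qed.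

Lemma integ_ge0 f : (forall x, 0 <= f x) -> 0 <= integ f.
Proof. by move=> f0; apply: Rintegral_ge0. Qed.

Lemma EFin_integ f : itg f -> (integ f)%:E = (\int[mu]_x (f x)%:E)%E.
Proof. by move=> fi; rewrite /integ /Rintegral fineK//; exact: integrable_fin_num. Qed.

(** One exceptional point is enough for every use: the origin when a half-line integrand is
    reflected, or the point where a cut function jumps. *)
Lemma integ_ae f g c : measurable_fun setT f -> measurable_fun setT g ->
  (forall x, x != c -> f x = g x) -> integ f = integ g.
Proof.
move=> mf mg fg; rewrite /integ /Rintegral; congr fine.
apply: ae_eq_integral => //; [exact/measurable_EFinP|exact/measurable_EFinP|].
exists [set c]; split=> //; first exact: lebesgue_measure_set1.
by move=> x /= h; apply: contrapT => /eqP xc; apply: h => _; rewrite fg.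
Qed.

Lemma itg_ae f g c : measurable_fun setT f ->
  (forall x, x != c -> f x = g x) -> itg g -> itg f.
Proof.
move=> mf fg gi; have [mg gfin] := integrableP _ _ _ gi.
apply/integrableP; split; first exact/measurable_EFinP.
rewrite (le_lt_trans _ gfin)// le_eqVlt; apply/orP; left; apply/eqP.
apply: ae_eq_integral => //.
- by apply: measurableT_comp => //; exact/measurable_EFinP.
- exact: measurableT_comp.
exists [set c]; split=> //; first exact: lebesgue_measure_set1.
by move=> x /= h; apply: contrapT => /eqP xc; apply: h => _; rewrite fg.
Qed.

(** Lebesgue measure is determined by its values on intervals; the push-forward of a times [mu]
    under x -> a x + b has the same values, hence is [mu]. *)
Lemma ge0_integral_affine (a b : R) (f : measurableTypeR R -> \bar R) : 0 < a ->
  measurable_fun setT f -> (forall x, 0 <= f x)%E ->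
  (\int[mu]_x f x = a%:E * \int[mu]_x f (a * x + b)%R)%E.
Proof.
move=> a0 mf f0.
pose phi : measurableTypeR R -> measurableTypeR R := fun x => a * x + b.
have mphi : measurable_fun setT phi.
  by apply: measurable_funD => //; exact: measurable_funM.
pose k : {nonneg R} := NngNum (ltW a0).
have H A : measurable A -> mu A = pushforward (mscale k mu) phi A.
  move=> mA; apply: (lebesgue_measure_unique
    (mu := pushforward (mscale k mu) phi)) => // _ [[p q]] _ <-.
  transitivity (a%:E * mu `]((p - b) / a)%R, ((q - b) / a)%R]%classic)%E; last first.
    congr (_ * mu _)%E; apply/seteqP; split=> x /=.
      rewrite !in_itv/= ler_pdivlMr// ltr_pdivrMr// [x * a]mulrC.
      by move=> /andP[h1 h2]; apply/andP; split; rewrite /phi; lra.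
    rewrite !in_itv/= ler_pdivlMr// ltr_pdivrMr// [x * a]mulrC.
    by rewrite /phi => /andP[h1 h2]; apply/andP; split; lra.
  rewrite !lebesgue_measure_itv/= !lte_fin ltr_pM2r ?invr_gt0// ltrD2r.
  case: ifPn => _; last by rewrite mule0.
  by rewrite -!EFinD -EFinM; congr EFin; field; rewrite gt_eqF.
rewrite (eq_measure_integral (pushforward (mscale k mu) phi)); last first.
  by move=> A mA _; exact: H.
rewrite ge0_integral_pushforward//= preimage_setT ge0_integral_mscale//=.
by apply: measurableT_comp.
Qed.

Lemma ge0_integral_opp (f : measurableTypeR R -> \bar R) :
  measurable_fun setT f -> (forall x, 0 <= f x)%E ->
  (\int[mu]_x f x = \int[mu]_x f (- x)%R)%E.
Proof.
move=> mf f0.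
rewrite (eq_measure_integral (pushforward mu (-%R : _ -> measurableTypeR R)));
  last by move=> A mA _; exact/esym/lebesgue_measureN.
by rewrite ge0_integral_pushforward.
Qed.

Lemma measurable_affine (a b : R) (f : R -> R) : measurable_fun setT f ->
  measurable_fun setT (fun x => f (a * x + b)).
Proof.
move=> mf; apply: measurableT_comp => //.
by apply: measurable_funD => //; exact: measurable_funM.
Qed.

Lemma itg_affine a b f : 0 < a -> itg f -> itg (fun x => f (a * x + b)).
Proof.
move=> a0 fi; have mf := itg_mf fi; have [_ fin] := integrableP _ _ _ fi.
apply/integrableP; split; first by apply/measurable_EFinP; exact: measurable_affine.
move: fin; rewrite (@ge0_integral_affine a b)//; last first.
  by apply: measurableT_comp => //; exact/measurable_EFinP.
move=> fin; rewrite -(@lte_pmul2l _ a%:E)// (lt_le_trans fin)//.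
by rewrite gt0_muley// lte_fin.
Qed.

Lemma itg_opp f : itg f -> itg (fun x => f (- x)).
Proof.
move=> fi; have mf := itg_mf fi; have [_ fin] := integrableP _ _ _ fi.
apply/integrableP; split; first by apply/measurable_EFinP; apply: measurableT_comp.
move: fin; rewrite (@ge0_integral_opp (abse \o (EFin \o f)))//.
- by apply: measurableT_comp => //; exact/measurable_EFinP.
- by move=> x; exact: abse_ge0.
Qed.

Lemma integ_posneg f : itg f ->
  integ f = integ (fun x => maxr (f x) 0) - integ (fun x => maxr (- f x) 0).
Proof.
move=> fi; have mf := itg_mf fi.
have h (g : R -> R) : itg g -> itg (fun x => maxr (g x) 0).
  move=> gi; apply: (itg_le (g := fun x => `|g x|)).
  - by apply: measurable_maxr => //; exact: itg_mf.
  - by move=> x; rewrite /Num.max; case: ltP => //; rewrite ?normr0.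
  - exact: (integrable_abse gi).
rewrite -integB.
- by apply: integ_eq => x; rewrite /Num.max; case: ltP => ?; case: ltP => ?; lra.
- exact: h.
- by apply: (h (fun x => - f x)); apply: (itg_eq _ (itgZ (-1) fi)) => x; ring.
Qed.

Lemma integ_affine a b f : 0 < a -> itg f ->
  integ f = a * integ (fun x => f (a * x + b)).
Proof.
move=> a0 fi; rewrite (integ_posneg fi) (integ_posneg (itg_affine b a0 fi)).
have h (g : R -> R) : measurable_fun setT g ->
    integ (fun x => maxr (g x) 0) = a * integ (fun x => maxr (g (a * x + b)) 0).
  move=> mg; rewrite /integ /Rintegral (@ge0_integral_affine a b)//.
  - set I := (\int[mu]_x (maxr (g (a * x + b)) 0)%:E)%E.
    (* [fine] sends infinite values to 0 and a factor a > 0 preserves them, so the identity also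
       holds when the integral diverges. *)
    by case: I => [r| |]//=; rewrite ?gt0_muley ?gt0_muleNy ?lte_fin//= mulr0.
  - by apply/measurable_EFinP; exact: measurable_maxr.
  - by move=> x; rewrite lee_fin le_max lexx orbT.
rewrite mulrBr; congr (_ - _); first exact: h (itg_mf fi).
by apply: (h (fun x => - f x)); apply: measurableT_comp => //; exact: itg_mf.
Qed.

Lemma integ_shift b f : itg f -> integ f = integ (fun x => f (x + b)).
Proof.
by move=> fi; rewrite (@integ_affine 1 b)// mul1r; apply: integ_eq => x; rewrite mul1r.
Qed.

Lemma itg_shift b f : itg f -> itg (fun x => f (x + b)).
Proof. by move=> /(@itg_affine 1 b _ ltr01); apply: itg_eq => x; rewrite mul1r. Qed.

Lemma integ_opp f : itg f -> integ f = integ (fun x => f (- x)).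
Proof.
move=> fi; rewrite (integ_posneg fi) (integ_posneg (itg_opp fi)).
have h (g : R -> R) : measurable_fun setT g ->
    integ (fun x => maxr (g x) 0) = integ (fun x => maxr (g (- x)) 0).
  move=> mg; rewrite /integ /Rintegral ge0_integral_opp//.
  - by apply/measurable_EFinP; exact: measurable_maxr.
  - by move=> x; rewrite lee_fin le_max lexx orbT.
rewrite !(h f) ?(h (fun x => - f x))//; last exact: itg_mf.
by apply: measurableT_comp => //; exact: itg_mf.
Qed.

Definition itg2 (F : R -> R -> R) : Prop :=
  (mu \x mu)%E.-integrable setT (fun z => (F z.1 z.2)%:E).

Definition meas2 (F : R -> R -> R) : Prop :=
  measurable_fun setT (fun z : R * R => F z.1 z.2).

Lemma meas2_l F x : meas2 F -> measurable_fun setT (F x).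
Proof. by move=> mF; exact: (measurableT_comp mF (measurable_pair1 x)). Qed.

Lemma itg2_le G F : meas2 F -> (forall x y, `|F x y| <= G x y) -> itg2 G -> itg2 F.
Proof.
move=> mF FG; apply: le_integrable => //; first exact/measurable_EFinP.
by move=> x _ /=; rewrite lee_fin (le_trans (FG _ _))// ler_norm.
Qed.

Lemma itg2_prod g h : itg g -> itg h -> itg2 (fun x y => g x * h y).
Proof.
move=> gi hi; apply/integrable12ltyP.
  apply/measurable_EFinP/measurable_funM.
    exact: (measurableT_comp (itg_mf gi)).
  exact: (measurableT_comp (itg_mf hi)).
under eq_integral => x _.
  under eq_integral do rewrite /= normrM EFinM.
  rewrite ge0_integralZl//; last first.
    by apply/measurable_EFinP; apply: measurableT_comp => //; exact: itg_mf hi.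
  over.
have hf : (\int[mu]_y `|h y|%:E < +oo)%E by have [] := integrableP _ _ _ hi.
have [_ gf] := integrableP _ _ _ gi.
rewrite ge0_integralZr//=.
- by apply: lte_mul_pinfty => //; [exact: integral_ge0|rewrite ge0_fin_numE//; exact: integral_ge0].
- by apply/measurable_EFinP; apply: measurableT_comp => //; exact: itg_mf gi.
- by apply: integral_ge0.
Qed.

Lemma itg2D F G : itg2 F -> itg2 G -> itg2 (fun x y => F x y + G x y).
Proof. by move=> fi gi; exact: integrableD fi gi. Qed.

(** Inner integrals are made real by [fine], so [integ (F x)] agrees with the extended-real
    [fubini_F] only where [F x] is integrable. That is almost every x, and both claims follow from
    this equality almost everywhere. *)
Lemma itg2_integ F : itg2 F -> itg (fun x => integ (F x)) /\
  integ (fun x => integ (F x)) = fine (\int[mu \x mu]_z (F z.1 z.2)%:E)%E.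
Proof.
move=> Fi; have mF : meas2 F by apply/measurable_EFinP; exact: measurable_int Fi.
have I1 := integrable_fubini_F Fi.
have ae1 := ae_integrable1 Fi.
have mf : measurable_fun setT (fun x => (integ (F x))%:E).
  apply: measurableT_comp => //; apply: measurableT_comp => //.
  exact: measurable_int I1.
have ae : ae_eq mu setT (fun x => (integ (F x))%:E) (fubini_F mu (fun z => (F z.1 z.2)%:E)).
  apply: filterS ae1 => x Fxi _ /=; rewrite /fubini_F -EFin_integ//.
split.
  apply/integrableP; split=> //; have [_ fin] := integrableP _ _ _ I1.
  rewrite (le_lt_trans _ fin)// le_eqVlt; apply/orP; left; apply/eqP.
  apply: ae_eq_integral => //.
  - by apply: measurableT_comp.
  - by apply: measurableT_comp => //; exact: measurable_int I1.
  - by apply: filterS ae => x /(_ I) h _; rewrite -[fubini_F _ _ _]h.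
rewrite -(integral12_prod_meas1 Fi) [LHS]/integ /Rintegral; congr fine.
apply: ae_eq_integral => //; exact: measurable_int I1.
Qed.

Lemma itg2_swap F : itg2 F -> itg2 (fun x y => F y x).
Proof.
move=> Fi; have mF : meas2 F by apply/measurable_EFinP; exact: measurable_int Fi.
have mF' : meas2 (fun x y => F y x).
  by apply: (measurableT_comp (f := fun z : R * R => F z.1 z.2) mF (measurable_swap (T1 := R) (T2 := R))).
apply/integrable21ltyP; first exact/measurable_EFinP.
by have /integrable12ltyP : itg2 F by []; apply; exact/measurable_EFinP.
Qed.

Lemma integ_swap F : itg2 F ->
  integ (fun x => integ (F x)) = integ (fun y => integ (F^~ y)).
Proof.
move=> Fi; rewrite (itg2_integ Fi).2 (itg2_integ (itg2_swap Fi)).2.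
by rewrite -(integral12_prod_meas1 Fi) -(integral21_prod_meas1 (itg2_swap Fi)).
Qed.

(** Reduces to sequences tending to x0. The majorant is required only near x0, so it applies from
    some index N on and the sequence is shifted by N. The point c allows one value of y at which
    continuity in the parameter fails. *)
Lemma integ_dominated_cvg (f : R -> R -> R) (g : R -> R) (x0 c : R) : itg g ->
  (\forall x \near x0, measurable_fun setT (f x) /\ forall y, `|f x y| <= g y) ->
  (forall y, y != c -> f x y @[x --> x0] --> f x0 y) ->
  integ (f x) @[x --> x0] --> integ (f x0).
Proof.
move=> gi near_f cf.
apply/(@cvg_nbhsP _ R^o) => u ux0.
have [N _ HN] : \forall n \near \oo,
   measurable_fun setT (f (u n)) /\ forall y, `|f (u n) y| <= g y by exact: ux0 near_f.
rewrite -(cvg_shiftn N) /=.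
have mfN n : measurable_fun setT (f (u (n + N)%N)) by apply: (HN _ _).1; exact: leq_addl.
have fgN n y : `|f (u (n + N)%N) y| <= g y by apply: (HN _ _).2; exact: leq_addl.
have [m0 _] := nbhs_singleton near_f.
have ae : {ae mu, forall x, setT x ->
    (f (u (n + N)%N) x)%:E @[n --> \oo] --> (EFin \o f x0) x}.
  exists [set c]; split=> //; first exact: lebesgue_measure_set1.
  move=> y /= h; apply: contrapT => /eqP yc; apply: h => _.
  apply: cvg_EFin; first by near=> n.
  move/(cvg_nbhsP (V := R^o)) : (cf y yc) => /(_ u ux0).
  by rewrite -(cvg_shiftn N).
have ae2 : {ae mu, forall x n, setT x -> (`|(f (u (n + N)%N) x)%:E| <= (EFin \o g) x)%E}.
  by apply: aeW => y n _; rewrite /= lee_fin.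
have [g0i _ ] := @dominated_convergence _ _ _ mu setT measurableT
  (fun n y => (f (u (n + N)%N) y)%:E) (EFin \o f x0) (EFin \o g)
  (fun n => (measurable_EFinP _ _).2 (mfN n)) ((measurable_EFinP _ _).2 m0) ae gi ae2.
by rewrite -EFin_integ//; exact: fine_cvg.
Unshelve. all: by end_near.
Qed.

End Integrals.

(** * Derivatives, measurability, integrals on the half-line *)

Section Calculus.
Variable R : realType.
Implicit Types (f g : R -> R) (x : R).

Definition has_deriv f x (l : R) : Prop := is_derive x 1 f l.

Lemma has_deriv_eq f x l l' : has_deriv f x l -> l = l' -> has_deriv f x l'.
Proof. by move=> h <-. Qed.

Lemma has_derivD f g x df dg : has_deriv f x df -> has_deriv g x dg ->
  has_deriv (fun y => f y + g y) x (df + dg).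
Proof. exact: is_deriveD. Qed.

Lemma has_derivB f g x df dg : has_deriv f x df -> has_deriv g x dg ->
  has_deriv (fun y => f y - g y) x (df - dg).
Proof. exact: is_deriveB. Qed.

Lemma has_derivN f x df : has_deriv f x df -> has_deriv (fun y => - f y) x (- df).
Proof. exact: is_deriveN. Qed.

Lemma has_derivM f g x df dg : has_deriv f x df -> has_deriv g x dg ->
  has_deriv (fun y => f y * g y) x (f x * dg + g x * df).
Proof. exact: is_deriveM. Qed.

Lemma has_deriv_cst (c x : R) : has_deriv (fun=> c) x 0.
Proof. exact: is_derive_cst. Qed.

Lemma has_deriv_id x : has_deriv (fun y : R => y) x 1.
Proof. exact: is_derive_id. Qed.

Lemma has_deriv_comp f g x df dg : has_deriv f (g x) df ->
  has_deriv g x dg -> has_deriv (fun y => f (g y)) x (df * dg).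
Proof. exact: is_derive1_comp. Qed.

Lemma has_deriv_continuous f x df : has_deriv f x df -> {for x, continuous f}.
Proof. by move=> [h _]; apply/differentiable_continuous/derivable1_diffP. Qed.

Lemma has_deriv_expR x : has_deriv expR x (expR x).
Proof. exact: is_derive_expR. Qed.

Lemma has_deriv_sin x : has_deriv sin x (cos x).
Proof. exact: is_derive_sin. Qed.

Lemma has_deriv_cos x : has_deriv cos x (- sin x).
Proof. exact: is_derive_cos. Qed.

Lemma has_derivP f x : derivable f x 1 -> has_deriv f x (derive1 f x).
Proof. by move=> h; rewrite /has_deriv derive1E; exact: DeriveDef. Qed.

End Calculus.

Ltac deriv := repeat first
  [ exact: has_deriv_cst | exact: has_deriv_id
  | apply: has_derivB | apply: has_derivD | apply: has_derivN
  | apply: has_derivM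
  | apply: (@has_deriv_comp _ expR); [exact: has_deriv_expR|]
  | apply: (@has_deriv_comp _ sin); [exact: has_deriv_sin|]
  | apply: (@has_deriv_comp _ cos); [exact: has_deriv_cos|]
  | eassumption ].

(** * Measurability of explicit formulas *)

Section Measurability.
Variables (R : realType) (d : measure_display) (T : measurableType d).
Implicit Types (f g : T -> R).

Lemma measurable_comp_fun (h : R -> R) f : measurable_fun setT h ->
  measurable_fun setT f -> measurable_fun setT (fun x => h (f x)).
Proof. by move=> mh mf; exact: measurableT_comp. Qed.

(** Inversion is continuous off 0 and takes the value 0 at 0 by convention, so it is measurable by
    cases. *)
Lemma measurableV_fun f : measurable_fun setT f ->
  measurable_fun setT (fun x => (f x)^-1).
Proof.
apply: measurable_comp_fun.
rewrite [X in measurable_fun _ X](_ : _ = fun x : R => if x == 0 then 0 else x^-1).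
  apply: measurable_fun_if => //.
  - by apply: measurable_fun_eqr => //; exact: measurable_cst.
  - apply: open_continuous_measurable_fun.
      rewrite setTI (_ : _ @^-1` _ = [set x : R | x != 0]); first exact: open_neq.
      by apply/seteqP; split=> x /=; case: (x == 0).
    move=> x; rewrite inE/= => -[_ x0]; apply: inv_continuous.
    by rewrite x0.
by apply/funext => x; case: eqP => // ->; rewrite invr0.
Qed.

End Measurability.

Lemma measurable_sin_fun (R : realType) : measurable_fun setT (@sin R).
Proof. by apply: continuous_measurable_fun; exact: continuous_sin. Qed.

Lemma measurable_cos_fun (R : realType) : measurable_fun setT (@cos R).
Proof. by apply: continuous_measurable_fun; exact: continuous_cos. Qed.

Lemma measurable_sqrt_fun (R : realType) : measurable_fun setT (@Num.sqrt R).
Proof. by apply: continuous_measurable_fun; exact: sqrt_continuous. Qed.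

(** Syntax-directed; an abstract function is accepted when its measurability is among the
    hypotheses, which is why proofs introduce such facts before the call. *)
Ltac meas := cbv beta; lazymatch goal with
  | |- measurable_fun _ (fun _ => ?c) => exact: measurable_cst
  | |- measurable_fun _ (fun x => x) => exact: measurable_id
  | |- measurable_fun _ (fun x => x.1) => exact: measurable_fst
  | |- measurable_fun _ (fun x => x.2) => exact: measurable_snd
  | |- measurable_fun _ (fun x => @?f x + @?g x) =>
      apply: (@measurable_funD _ _ _ _ f g); meas
  | |- measurable_fun _ (fun x => @?f x * @?g x) =>
      apply: (@measurable_funM _ _ _ _ f g); meas
  | |- measurable_fun _ (fun x => - @?f x) =>
      apply: (measurable_comp_fun (f := f) (@oppr_measurable _ _)); meas
  | |- measurable_fun _ (fun x => (@?f x)^-1) =>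
      apply: (measurableV_fun (f := f)); meas
  | |- measurable_fun _ (fun x => @?f x ^+ ?n) =>
      apply: (@measurable_funX _ _ _ _ f n); meas
  | |- measurable_fun _ (fun x => `|@?f x|) =>
      apply: (measurable_comp_fun (f := f) (@normr_measurable _ _)); meas
  | |- measurable_fun _ (fun x => expR (@?f x)) =>
      apply: (measurable_comp_fun (f := f) (@measurable_expR _)); meas
  | |- measurable_fun _ (fun x => sin (@?f x)) =>
      apply: (measurable_comp_fun (f := f) (@measurable_sin_fun _)); meas
  | |- measurable_fun _ (fun x => cos (@?f x)) =>
      apply: (measurable_comp_fun (f := f) (@measurable_cos_fun _)); meas
  | |- measurable_fun _ (fun x => Num.sqrt (@?f x)) =>
      apply: (measurable_comp_fun (f := f) (@measurable_sqrt_fun _)); meas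
  | |- measurable_fun _ (fun x => match @?b x with true => @?f x | false => @?g x end) =>
      apply: (@measurable_fun_ifT _ _ _ _ f g b); meas
  | |- measurable_fun _ (fun x => @?f x < @?g x) =>
      apply: (@measurable_fun_ltr _ _ _ _ f g); meas
  | |- measurable_fun _ (fun x => @?f x <= @?g x) =>
      apply: (@measurable_fun_ler _ _ _ _ f g); meas
  | H : measurable_fun _ ?h |- measurable_fun _ (fun x => ?h (@?f x)) =>
      apply: (measurable_comp_fun (f := f) H); meas
  | |- _ => assumption
  end.

(** * Explicit integrals on the half-line *)

Section HalfLine.
Variable R : realType.
Local Notation mu := (@lebesgue_measure R).
Implicit Types (f F : R -> R).

Lemma integ_halfline f :
  integ (fun x => if 0 < x then f x else 0) = Rintegral mu `]0, +oo[ f.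
Proof.
rewrite Rintegral_mkcond; apply: eq_Rintegral => x _; rewrite patchE mem_setE.
by rewrite in_itv/= andbT.
Qed.

Lemma itg_halfline f : itg (fun x => if 0 < x then f x else 0) <->
  mu.-integrable `]0, +oo[ (EFin \o f).
Proof.
rewrite integrable_mkcond// /itg.
rewrite (_ : EFin \o _ = (EFin \o f) \_ `]0, +oo[)//.
apply/funext => x; rewrite patchE mem_setE in_itv/= andbT.
by rewrite /=; case: ifP.
Qed.

(** Nonnegativity makes the improper fundamental theorem yield integrability as well: the integral
    of |f| is the finite number l - F 0. *)
Lemma halfline_FTC f F (l : R) : (forall x : R, 0 <= x -> 0 <= f x) -> continuous f ->
  (forall x : R, has_deriv F x (f x)) -> F x @[x --> +oo] --> l ->
  itg (fun x => if 0 < x then f x else 0) /\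
  integ (fun x => if 0 < x then f x else 0) = l - F 0.
Proof.
move=> f0 cf dF Fl.
have E : (\int[mu]_(x in `]0%R, +oo[) (f x)%:E = l%:E - (F 0)%:E)%E.
  rewrite integral_itv_obnd_cbnd.
    apply: ge0_continuous_FTC2y => //.
    - exact: continuous_subspaceT.
    - by move=> x _; case: (dF x).
    - by apply: cvg_at_right_filter; apply: has_deriv_continuous (dF 0).
    - by move=> x _; rewrite derive1E; case: (dF x).
  by apply/measurable_EFinP; apply: measurable_funTS; exact: continuous_measurable_fun.
split; last by rewrite integ_halfline /Rintegral E.
apply/itg_halfline/integrableP; split.
  by apply/measurable_EFinP; apply: measurable_funTS; exact: continuous_measurable_fun.
under eq_integral => x.
  rewrite inE/= in_itv/= andbT => x0; rewrite ger0_norm ?f0// ?ltW//; over.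
by rewrite E -EFinB ltry.
Qed.

Lemma cvgy_expRN (s : R) : 0 < s -> expR (- (s * x)) @[x --> +oo] --> 0.
Proof.
move=> s0; apply: (cvg_comp (fun x => s * x) (fun x => expR (- x))); last exact: cvgr_expR.
exact: gt0_cvgMry.
Qed.

Lemma halfline_exp (s : R) : 0 < s ->
  itg (fun x => if 0 < x then expR (- (s * x)) else 0) /\
  integ (fun x => if 0 < x then expR (- (s * x)) else 0) = s^-1.
Proof.
move=> s0; have := @halfline_FTC (fun x => expR (- (s * x)))
  (fun x => - s^-1 * expR (- (s * x))) 0.
rewrite mulr0 oppr0 expR0 mulr1 sub0r opprK; apply.
- by move=> x _; exact: expR_ge0.
- by move=> x; apply: has_deriv_continuous; deriv.
- by move=> x; apply: has_deriv_eq; [deriv|cbv beta; field; rewrite gt_eqF].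
- rewrite -(mulr0 (- s^-1)); apply: cvgMl_tmp; exact: cvgy_expRN.
Qed.

(** The combination 1 - cos keeps the integrand nonnegative, as [halfline_FTC] requires; the
    transform of the cosine alone is recovered by subtraction in [poisson_kernel]. *)
Lemma halfline_cos (s k : R) : 0 < s ->
  itg (fun w => if 0 < w then 2 * (1 - cos (k * w)) * expR (- (w * s)) else 0) /\
  integ (fun w => if 0 < w then 2 * (1 - cos (k * w)) * expR (- (w * s)) else 0)
    = 2 * k ^+ 2 / (s * (s ^+ 2 + k ^+ 2)).
Proof.
move=> s0.
have sk0 : s ^+ 2 + k ^+ 2 != 0 by rewrite gt_eqF// ltr_wpDr ?sqr_ge0// exprn_gt0.
(* The antiderivative combines - exp (-s w) / s for the constant with (k sin (k w) - s cos (k w))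
   exp (-s w) / (s^2 + k^2) for the cosine. *)
have := @halfline_FTC (fun w => 2 * (1 - cos (k * w)) * expR (- (w * s)))
  (fun w => (- 2 / s - 2 * (k * sin (k * w) - s * cos (k * w)) / (s ^+ 2 + k ^+ 2))
     * expR (- (w * s))) 0.
rewrite !mulr0 !mul0r oppr0 sin0 cos0 expR0.
have -> : 0 - (- 2 / s - 2 * (k * 0 - s * 1) / (s ^+ 2 + k ^+ 2)) * 1 =
  2 * k ^+ 2 / (s * (s ^+ 2 + k ^+ 2)) by field; rewrite sk0 gt_eqF.
apply.
- move=> x _; apply: mulr_ge0; last exact: expR_ge0.
  by apply: mulr_ge0 => //; rewrite subr_ge0 cos_le1.
- by move=> x; apply: has_deriv_continuous; deriv.
- by move=> x; apply: has_deriv_eq; [deriv|cbv beta; field; rewrite sk0 gt_eqF].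
- pose C := 2 / s + 2 * (`|k| + s) / (s ^+ 2 + k ^+ 2).
  have H : C * expR (- (s * x)) @[x --> +oo] --> 0.
    by rewrite -(mulr0 C); apply: cvgMl_tmp; exact: cvgy_expRN.
  apply/norm_cvg0P; apply: (squeeze_cvgr (f := fun=> 0) (h := fun x => C * expR (- (s * x)))) => //.
  + near=> x; rewrite normr_ge0/= normrM [`|expR _|]ger0_norm ?expR_ge0// (mulrC x).
    rewrite ler_wpM2r ?expR_ge0// /C (le_trans (ler_normB _ _))// lerD//.
      by rewrite normrM normrN !ger0_norm// invr_ge0 ltW.
    rewrite normrM [X in _ * X <= _]ger0_norm ?invr_ge0 ?addr_ge0 ?sqr_ge0//.
    rewrite ler_wpM2r ?invr_ge0 ?addr_ge0 ?sqr_ge0// normrM ger0_norm//.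
    rewrite ler_wpM2l// (le_trans (ler_normB _ _))// lerD// normrM.
      by rewrite ler_piMr// ler_norml sin_geN1 sin_le1.
    by rewrite (gtr0_norm s0) ler_piMr ?(ltW s0)// ler_norml cos_geN1 cos_le1.
  + exact: cvg_cst.
Unshelve. all: by end_near.
Qed.

Lemma itg_exp_norm (b : R) : 0 < b -> itg (fun u => expR (- (b * `|u|))).
Proof.
move=> b0; have [h _] := halfline_exp b0.
apply: (@itg_ae _ _ (fun u => (if 0 < u then expR (- (b * u)) else 0) +
  (if 0 < - u then expR (- (b * - u)) else 0)) 0); first by meas.
- move=> u u0; rewrite oppr_gt0.
  case: (ltgtP 0 u) => [up|un|u00]; last by rewrite u00 eqxx in u0.
    by rewrite addr0 gtr0_norm.
  by rewrite add0r ltr0_norm.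
- by apply: itgD => //; exact: itg_opp h.
Qed.

(** For integrands in u = ln r: power behaviour at r = 0 gives the first bound, power behaviour at r
    = oo the second. They are used on opposite half-lines, with the smaller of the two rates. *)
Lemma itg_two_exp f (a b C : R) : 0 < a -> 0 < b -> measurable_fun setT f ->
  (forall u, `|f u| <= C * expR (a * u)) ->
  (forall u, `|f u| <= C * expR (- (b * u))) -> itg f.
Proof.
move=> a0 b0 mf fa fb.
have C0 : 0 <= C by have := fa 0; rewrite mulr0 expR0 mulr1; exact: le_trans.
have c0 : 0 < minr a b by rewrite lt_min a0 b0.
apply: (itg_le mf _ (itgZ C (itg_exp_norm c0))) => u.
have [u0|u0] := leP 0 u.
  rewrite (le_trans (fb u))// ler_wpM2l// ler_expR lerN2 ger0_norm//.
  by rewrite ler_wpM2r// ge_min lexx orbT.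
rewrite (le_trans (fa u))// ler_wpM2l// ler_expR ltr0_norm// mulrN opprK.
by rewrite ler_wnM2r// ?ge_min ?lexx// ltW.
Qed.

End HalfLine.

(** * The kernel *)

Section Kernel.
Variables (R : realType) (alpha : R).
Hypotheses (alpha_gt0 : 0 < alpha) (alpha_lt1 : alpha < 1).
Local Notation mu := (@lebesgue_measure R).

(** The rate s = sqrt (1 + r) at r = exp u. *)
Definition freq (u : R) : R := Num.sqrt (1 + expR u).

Lemma freq_sqr u : freq u ^+ 2 = 1 + expR u.
Proof. by rewrite sqr_sqrtr// addr_ge0// expR_ge0. Qed.

Lemma freq_ge1 u : 1 <= freq u.
Proof.
by rewrite -[leLHS]sqrtr1 ler_sqrt ?ltr_wpDr ?expR_ge0// lerDl expR_ge0.
Qed.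

Lemma freq_gt0 u : 0 < freq u.
Proof. exact: lt_le_trans (freq_ge1 u). Qed.

Lemma freq_ge_exp u : expR (u / 2) <= freq u.
Proof.
rewrite -(@ler_pXn2r _ 2)// ?nnegrE ?expR_ge0 ?(ltW (freq_gt0 _))//.
rewrite freq_sqr -expRM_natl (_ : 2 * (u / 2) = u); last by field.
by rewrite lerDr.
Qed.

Lemma measurable_freq : measurable_fun setT freq.
Proof. by rewrite /freq; meas. Qed.

(** The integrand of B at r = exp u; the Jacobian dr = r du raises r^(alpha-1) to r^alpha. *)
Definition beta_fun (u : R) : R := expR (alpha * u) / (1 + expR u).

Lemma measurable_beta_fun : measurable_fun setT beta_fun.
Proof. by rewrite /beta_fun; meas. Qed.

Lemma oneDexp_gt0 (u : R) : 0 < 1 + expR u.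
Proof. by rewrite ltr_wpDr// expR_ge0. Qed.

Lemma beta_fun_ge0 u : 0 <= beta_fun u.
Proof. by rewrite divr_ge0 ?expR_ge0// ltW// oneDexp_gt0. Qed.

Lemma itg_beta_fun : itg beta_fun.
Proof.
apply: (@itg_two_exp _ _ alpha (1 - alpha) 1) => //.
- by rewrite subr_gt0.
- exact: measurable_beta_fun.
- move=> u; rewrite mul1r ger0_norm ?beta_fun_ge0// ler_pdivrMr ?oneDexp_gt0//.
  by rewrite ler_peMr ?expR_ge0// lerDl expR_ge0.
- move=> u; rewrite mul1r ger0_norm ?beta_fun_ge0// ler_pdivrMr ?oneDexp_gt0//.
  rewrite mulrDr mulr1 -expRD (_ : - ((1 - alpha) * u) + u = alpha * u); last by ring.
  by rewrite lerDr expR_ge0.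
Qed.

Definition beta_int : R := integ beta_fun.

(** For u < 0 the denominator is at most 2, so the integral is at least 1 / (2 alpha); reflection
    brings this half-line to u > 0, where [halfline_exp] applies. *)
Lemma beta_int_gt0 : 0 < beta_int.
Proof.
rewrite /beta_int (integ_opp itg_beta_fun).
have [h1 h2] := halfline_exp alpha_gt0.
have h3 := itgZ 2^-1 h1.
apply: (@lt_le_trans _ _ (2^-1 * alpha^-1)); first by rewrite mulr_gt0// invr_gt0.
rewrite -h2 -(integZ _ h1); apply: le_integ => //; first exact: itg_opp itg_beta_fun.
move=> x; case: ltP => [x0|_]; last by rewrite mulr0 beta_fun_ge0.
rewrite /beta_fun mulrN mulrC ler_wpM2l ?expR_ge0// lef_pV2 ?posrE ?oneDexp_gt0//.
by rewrite -[2]/(1 + 1) lerD2l expR_le1 oppr_le0 ltW.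
Qed.

(* The weight of [exp (- |w| freq u)] in [mker], for the variable r = exp u
   of the Stieltjes representation of lambda^alpha. *)
Definition weight (u : R) : R := expR ((1 + alpha) * u) / (2 * freq u).

Lemma weight_ge0 u : 0 <= weight u.
Proof. by rewrite divr_ge0 ?expR_ge0// mulr_ge0// ltW// freq_gt0. Qed.

Lemma measurable_weight : measurable_fun setT weight.
Proof. by have mf := measurable_freq; rewrite /weight; meas. Qed.

Definition kfun (w u : R) : R := weight u * expR (- (w * freq u)).

Lemma kfun_ge0 w u : 0 <= kfun w u.
Proof. by rewrite mulr_ge0 ?weight_ge0 ?expR_ge0. Qed.

Lemma measurable_kfun : meas2 kfun.
Proof.
have mf := measurable_freq; have mw := measurable_weight.
by rewrite /meas2 /kfun; meas.
Qed.

(** Zero on w <= 0, so that integrals over w > 0 run over the whole line and m(|x - y|) = m(x - y) +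
    m(y - x). *)
Definition mker (w : R) : R := if 0 < w then beta_int^-1 * integ (kfun w) else 0.

Lemma mker_ge0 w : 0 <= mker w.
Proof.
rewrite /mker; case: ifP => // _.
rewrite mulr_ge0 ?invr_ge0 ?(ltW beta_int_gt0)//; apply: integ_ge0.
exact: kfun_ge0.
Qed.

Lemma mker_le0 w : w <= 0 -> mker w = 0.
Proof. by rewrite /mker ltNge => ->. Qed.

Lemma measurable_mker : measurable_fun setT mker.
Proof.
apply: (@measurable_fun_ifT _ _ _ _ (fun w => beta_int^-1 * integ (kfun w))
  (fun=> 0) (fun w => 0 < w)); [by meas| |by meas].
apply: measurable_funM => //; apply: measurableT_comp => //.
apply: (measurable_fun_fubini_tonelli_F (m2 := mu) (fun z => (kfun z.1 z.2)%:E)) => /=.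
- by apply/measurable_EFinP; exact: measurable_kfun.
- by move=> z; rewrite lee_fin kfun_ge0.
Qed.

(** The profile of [kfun] at w = 1, up to the factor 1/2, when [freq u] is replaced by its lower
    bound exp (u / 2). A general w only translates it by 2 ln w, which does not change its
    integral. *)
Definition small_fun (u : R) : R := expR ((2^-1 + alpha) * u) * expR (- expR (u / 2)).

Lemma itg_small_fun : itg small_fun.
Proof.
have ge0 u : 0 <= small_fun u by rewrite mulr_ge0 ?expR_ge0.
(* The constant 24 is 4!, from exp y >= y^4 / 4! at y = exp (u / 2). The fourth power gives exp (2
   u), which leaves the decay rate 2 - (1/2 + alpha), positive because alpha < 1. *)
apply: (@itg_two_exp _ _ (2^-1 + alpha) (3 / 2 - alpha) 24) => //.
- by rewrite addr_gt0// invr_gt0.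
- have := alpha_lt1; lra.
- by rewrite /small_fun; meas.
- move=> u; rewrite ger0_norm// /small_fun mulrC ler_wpM2r ?expR_ge0//.
  by rewrite (@le_trans _ _ 1)// ?expR_le1 ?oppr_le0 ?expR_ge0// ler1n.
- move=> u; rewrite ger0_norm// /small_fun.
  have h := @expR_ge1Dxn R (expR (u / 2)) 3 (expR_ge0 _).
  have h4 : expR (u / 2) ^+ 4 = expR (2 * u) by rewrite -expRM_natl; congr expR; field.
  rewrite h4 in h.
  have h' : expR (2 * u) <= 24 * expR (expR (u / 2)).
    have f4 : (4`!)%:R = 24 :> R by [].
    by rewrite f4 in h; lra.
  rewrite expRN ler_pdivrMr ?expR_gt0//.
  rewrite -(@ler_pM2l _ (expR ((3 / 2 - alpha) * u))) ?expR_gt0//.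
  rewrite -expRD (_ : _ * u + _ * u = 2 * u); last by field.
  by rewrite expRN -mulrA mulrCA [X in _ <= _ * X]mulrA divff ?mul1r// gt_eqF// expR_gt0.
Qed.

(** The power of w undoes the factor w^(1 + 2 alpha) that the translation by 2 ln w produces in the
    first exponential. *)
Lemma kfun_le_small w u : 0 < w ->
  kfun w u <= 2^-1 * powR w (- 1 - 2 * alpha) * small_fun (u + 2 * ln w).
Proof.
move=> w0; rewrite /kfun /weight /small_fun /powR gt_eqF//.
have -> : expR ((u + 2 * ln w) / 2) = w * expR (u / 2).
  by rewrite -{2}(lnK (x := w)) ?posrE// -expRD; congr expR; field.
have -> : expR ((2^-1 + alpha) * (u + 2 * ln w)) =
   expR ((2^-1 + alpha) * u) * expR ((1 + 2 * alpha) * ln w).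
  by rewrite -expRD; congr expR; field.
rewrite [X in _ <= X](_ : _ = 2^-1 * expR ((2^-1 + alpha) * u) * expR (- (w * expR (u / 2)))); last first.
  transitivity (2^-1 * (expR ((- 1 - 2 * alpha) * ln w) * expR ((1 + 2 * alpha) * ln w))
    * expR ((2^-1 + alpha) * u) * expR (- (w * expR (u / 2)))); first by ring.
  rewrite -expRD (_ : _ * ln w + _ * ln w = 0); last by ring.
  by rewrite expR0 mulr1.
apply: ler_pM; rewrite ?expR_ge0//.
- by rewrite divr_ge0 ?expR_ge0// mulr_ge0// ltW// freq_gt0.
- rewrite ler_pdivrMr ?mulr_gt0 ?freq_gt0//.
  rewrite (_ : 2^-1 * _ * _ = expR ((2^-1 + alpha) * u) * freq u); last by field.
  rewrite (_ : (1 + alpha) * u = (2^-1 + alpha) * u + u / 2); last by field.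
  by rewrite expRD ler_wpM2l ?expR_ge0// freq_ge_exp.
- by rewrite ler_expR lerN2 ler_wpM2l ?(ltW w0)// freq_ge_exp.
Qed.

Lemma itg_kfun w : 0 < w -> itg (kfun w).
Proof.
move=> w0; apply: (itg_le _ _ (itgZ (2^-1 * powR w (- 1 - 2 * alpha))
  (itg_shift (2 * ln w) itg_small_fun))).
- exact: meas2_l measurable_kfun.
- by move=> u; rewrite ger0_norm ?kfun_ge0//; exact: kfun_le_small.
Qed.

Lemma mker_small : exists M, forall w, 0 < w -> `|mker w| <= M * powR w (- 1 - 2 * alpha).
Proof.
exists (beta_int^-1 * 2^-1 * integ small_fun) => w w0.
rewrite ger0_norm ?mker_ge0// /mker w0.
rewrite -!mulrA ler_wpM2l ?invr_ge0 ?(ltW beta_int_gt0)//.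
rewrite (integ_shift (2 * ln w) itg_small_fun).
rewrite (mulrC (integ _)) mulrA -integZ; last exact: itg_shift itg_small_fun.
apply: le_integ; [exact: itg_kfun| |by move=> u; exact: kfun_le_small].
by apply: itgZ; exact: itg_shift itg_small_fun.
Qed.

(** As s = [freq u] is at least 1, exp (-w s) = exp (-(w - 1) s) exp (-s) <= exp (1 - w) exp (-s)
    for w >= 1. *)
Lemma mker_large w : 1 <= w -> `|mker w| <= (expR 1 * mker 1) * expR (- w).
Proof.
move=> w1; have w0 : 0 < w by exact: lt_le_trans w1.
rewrite ger0_norm ?mker_ge0// /mker w0 ltr01.
rewrite [X in _ <= X](_ : _ = beta_int^-1 * (expR (1 - w) * integ (kfun 1))); last first.
  by rewrite expRD; ring.
rewrite ler_wpM2l ?invr_ge0 ?(ltW beta_int_gt0)// -integZ; last exact: itg_kfun.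
apply: le_integ; [exact: itg_kfun|by apply: itgZ; exact: itg_kfun|].
move=> u; rewrite /kfun mulrCA ler_wpM2l ?weight_ge0// -expRD ler_expR.
have := freq_ge1 u; set s := freq u => s1; nra.
Qed.

(** Exchanges integration against [mker] with the u-integral defining it, G certifying that the
    iterated integral is finite. It serves twice: with phi = w^2 for integrability alone, and with
    phi = 2 (1 - cos (xi w)) for the exact value. *)
Lemma mker_tonelli (phi G : R -> R) :
  measurable_fun setT phi -> (forall w, 0 <= phi w) ->
  (forall u, itg (fun w => if 0 < w then phi w * expR (- (w * freq u)) else 0)) ->
  itg G -> (forall u, weight u *
     integ (fun w => if 0 < w then phi w * expR (- (w * freq u)) else 0) <= G u) ->
  itg (fun w => phi w * mker w) /\ integ (fun w => phi w * mker w) =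
    beta_int^-1 * integ (fun u => weight u *
     integ (fun w => if 0 < w then phi w * expR (- (w * freq u)) else 0)).
Proof.
move=> mphi phi0 ie iG le_G.
have mf := measurable_freq; have mw := measurable_weight.
pose F u w := weight u * (if 0 < w then phi w * expR (- (w * freq u)) else 0).
have F0 u w : 0 <= F u w.
  rewrite mulr_ge0 ?weight_ge0//; case: ifP => // _.
  by rewrite mulr_ge0 ?phi0 ?expR_ge0.
have mF : meas2 F by rewrite /meas2 /F; meas.
have iF u : itg (F u) by exact: itgZ.
have F2 : itg2 F.
  apply/integrable12ltyP; first exact/measurable_EFinP.
  apply: (@le_lt_trans _ _ (\int[mu]_u (G u)%:E)%E); last exact: integrable_lty iG.
  apply: ge0_le_integral => //.
  - by move=> u _; apply: integral_ge0.
  - apply: (measurable_fun_fubini_tonelli_F (m2 := mu) (fun z => `|(F z.1 z.2)%:E|%E)) => //=.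
    apply/measurable_EFinP.
    exact: (measurable_comp_fun (@normr_measurable R setT) mF).
  - by apply/measurable_EFinP; exact: itg_mf iG.
  - move=> u _; under eq_integral do rewrite /= ger0_norm ?F0//.
    by rewrite -EFin_integ// lee_fin [integ _]integZ.
have [i1 _] := itg2_integ (itg2_swap F2).
have E w : phi w * mker w = beta_int^-1 * integ (F^~ w).
  rewrite /F /mker; case: ifPn => w0.
    rewrite mulrCA -integZ; last exact: itg_kfun.
    by congr (_ * _); apply: integ_eq => u; rewrite /kfun mulrCA.
  by rewrite (integ_eq (g := fun=> 0)) ?integ0 ?mulr0// => u; rewrite mulr0.
split; first by apply: (itg_eq _ (itgZ beta_int^-1 i1)) => w; rewrite E.
rewrite (integ_eq E) integZ// -(integ_swap F2); congr (_ * _).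
by apply: integ_eq => u; rewrite integZ.
Qed.

Lemma itg_sqr_mker : itg (fun w => w ^+ 2 * mker w).
Proof.
have mf := measurable_freq; have mw := measurable_weight.
(* The inner integral of w^2 exp (-w s) is 2 / s^3; only the order s^-3 matters, and 32 covers the
   crude estimate below. Since s^2 = 1 + exp u, G behaves like exp ((1 + alpha) u) at -oo and like
   exp ((alpha - 1) u) at +oo. *)
pose G u := 32 * (weight u / freq u ^+ 3).
have iG : itg G.
  have G0 u : 0 <= G u.
    by rewrite mulr_ge0// divr_ge0 ?weight_ge0// exprn_ge0// ltW// freq_gt0.
  have GE u : G u = 16 * expR ((1 + alpha) * u) / (1 + expR u) ^+ 2.
    by rewrite /G /weight -freq_sqr; field; rewrite gt_eqF ?freq_gt0.
  apply: (@itg_two_exp _ _ (1 + alpha) (1 - alpha) 16) => //.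
  - by rewrite addr_gt0.
  - by rewrite subr_gt0.
  - by rewrite /G; meas.
  - move=> u; rewrite ger0_norm// GE ler_pdivrMr ?exprn_gt0 ?oneDexp_gt0//.
    by rewrite ler_peMr ?mulr_ge0 ?expR_ge0// exprn_ege1// lerDl expR_ge0.
  - move=> u; rewrite ger0_norm// GE ler_pdivrMr ?exprn_gt0 ?oneDexp_gt0//.
    rewrite -mulrA ler_wpM2l// (_ : (1 + alpha) * u = - ((1 - alpha) * u) + 2 * u); last by ring.
    rewrite expRD ler_wpM2l ?expR_ge0// expRM_natl.
    by rewrite lerXn2r ?nnegrE ?addr_ge0 ?expR_ge0// lerDr.
(* exp t >= t^2 / 2 at t = w s / 2 trades w^2 for 8 / s^2 and half of the exponential rate. *)
have bd u w : 0 < w -> w ^+ 2 * expR (- (w * freq u)) <=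
    8 / freq u ^+ 2 * expR (- (freq u / 2 * w)).
  move=> w0; have s0 := freq_gt0 u; set s := freq u in s0 *.
  have ws0 : 0 <= w * s / 2 by rewrite divr_ge0// mulr_ge0// ltW.
  have h := @expR_ge1Dxn R _ 1 ws0.
  have {}h : w ^+ 2 * s ^+ 2 <= 8 * expR (w * s / 2).
    have : (w * s / 2) ^+ 2 / 2 <= expR (w * s / 2).
      by apply: le_trans h; rewrite lerDr.
    have -> : (w * s / 2) ^+ 2 / 2 = w ^+ 2 * s ^+ 2 / 8 by field.
    by lra.
  rewrite [leRHS]mulrAC ler_pdivlMr ?exprn_gt0// mulrAC.
  rewrite (_ : - (s / 2 * w) = w * s / 2 + - (w * s)); last by field.
  by rewrite expRD [leRHS]mulrA ler_wpM2r ?expR_ge0.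
have he u := halfline_exp (divr_gt0 (freq_gt0 u) (ltr0n _ 2)).
have iu u : itg (fun w => if 0 < w then w ^+ 2 * expR (- (w * freq u)) else 0).
  apply: (itg_le _ _ (itgZ (8 / freq u ^+ 2) (he u).1)); first by meas.
  move=> w; case: ltP => w0; last by rewrite normr0 mulr0.
  by rewrite ger0_norm ?bd// mulr_ge0 ?sqr_ge0 ?expR_ge0.
have msq : measurable_fun setT (fun w : R => w ^+ 2) by meas.
apply: (proj1 (mker_tonelli msq (@sqr_ge0 R) iu iG _)) => u.
rewrite /G mulrCA ler_wpM2l ?weight_ge0//.
rewrite (_ : 32 * _ = 8 / freq u ^+ 2 * (4 / freq u)); last first.
  by field; rewrite gt_eqF ?freq_gt0.
apply: (@le_trans _ _ (8 / freq u ^+ 2 * (freq u / 2)^-1)).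
  rewrite -(he u).2 -integZ; last exact: (he u).1.
  apply: le_integ => //; first by apply: itgZ; exact: (he u).1.
  by move=> w; case: ltP => w0; [exact: bd|rewrite mulr0].
rewrite ler_wpM2l ?divr_ge0 ?sqr_ge0// invf_div ler_wpM2r ?invr_ge0 ?(ltW (freq_gt0 _))//.
by rewrite ler_nat.
Qed.

(** [weight u] times the inner integral is r^alpha (lambda / (lambda + r) - 1 / (1 + r)) at r = exp
    u, that is lambda^alpha [beta_fun] (u - ln lambda) - [beta_fun] u. Translation invariance makes
    its integral (lambda^alpha - 1) B without computing B. *)
Lemma symb_mker (xi : R) :
  itg (fun w => 2 * (1 - cos (xi * w)) * mker w) /\
  symb alpha xi = 1 + integ (fun w => 2 * (1 - cos (xi * w)) * mker w).
Proof.
have mf := measurable_freq; have mw := measurable_weight.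
pose L := 1 + xi ^+ 2.
have L0 : 0 < L by rewrite ltr_wpDr ?sqr_ge0.
have shift_beta u : beta_fun (u + - ln L) = expR (- (alpha * ln L)) * (expR (alpha * u) * (L / (L + expR u))).
  rewrite /beta_fun mulrDr expRD [expR (u - _)]expRD mulrN !expRN lnK ?posrE//.
  by field; do ?[apply/andP; split]; rewrite gt_eqF ?expR_gt0// addr_gt0 ?expR_gt0.
pose G u := expR (alpha * ln L) * beta_fun (u + - ln L) - beta_fun u.
have iG1 : itg (fun u => expR (alpha * ln L) * beta_fun (u + - ln L)).
  by apply: itgZ; exact: itg_shift itg_beta_fun.
have iG : itg G by apply: itgB => //; exact: itg_beta_fun.
have GE u : weight u * (2 * xi ^+ 2 / (freq u * (freq u ^+ 2 + xi ^+ 2))) = G u.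
  rewrite /G shift_beta [X in X - _]mulrA -expRD subrr expR0 mul1r /beta_fun /weight.
  rewrite (_ : (1 + alpha) * u = alpha * u + u); last by ring.
  rewrite expRD /L -/L.
  have f0 : freq u != 0 by rewrite gt_eqF ?freq_gt0.
  have e0 : 1 + expR u != 0 by rewrite gt_eqF ?oneDexp_gt0.
  have x0 : 1 + xi ^+ 2 + expR u != 0 by rewrite gt_eqF// addr_gt0 ?expR_gt0.
  have x1 : 1 + expR u + xi ^+ 2 != 0 by rewrite addrAC.
  transitivity (expR (alpha * u) * expR u * xi ^+ 2 / (freq u ^+ 2 * (freq u ^+ 2 + xi ^+ 2))).
    by rewrite freq_sqr -freq_sqr; field; rewrite f0 freq_sqr x1.
  by rewrite freq_sqr /L; field; rewrite e0 x0.
have h u := halfline_cos xi (freq_gt0 u).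
have [|||||i1 i2] := @mker_tonelli (fun w => 2 * (1 - cos (xi * w))) G.
- by meas.
- by move=> w; apply: mulr_ge0 => //; rewrite subr_ge0 cos_le1.
- by move=> u; exact: (h u).1.
- exact: iG.
- by move=> u; rewrite (h u).2 GE.
split=> //; rewrite i2 (integ_eq (g := G)); last by move=> u; rewrite (h u).2 GE.
rewrite integB//; last exact: itg_beta_fun.
rewrite integZ; last exact: itg_shift itg_beta_fun.
rewrite -(integ_shift _ itg_beta_fun) -/beta_int /symb -/L /powR gt_eqF//.
by field; rewrite gt_eqF// beta_int_gt0.
Qed.

End Kernel.

(** * Decay of Schwartz functions *)

Section Decay.
Variable R : realType.
Local Notation mu := (@lebesgue_measure R).
Implicit Types (f p : R -> R).

Lemma oneD_sqr_gt0 (x : R) : 0 < 1 + x ^+ 2.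
Proof. by rewrite ltr_wpDr ?sqr_ge0. Qed.

Lemma inv_oneDsqr_ge0 (x : R) : 0 <= (1 + x ^+ 2)^-1.
Proof. by rewrite invr_ge0 ltW// oneD_sqr_gt0. Qed.

Lemma itg_even f : measurable_fun setT f -> (forall x, f (- x) = f x) ->
  itg (fun x => if 0 < x then f x else 0) ->
  itg f /\ integ f = 2 * integ (fun x => if 0 < x then f x else 0).
Proof.
move=> mf fN hi.
have hN := itg_opp hi.
have E x : x != 0 -> f x = (if 0 < x then f x else 0) + (if 0 < - x then f (- x) else 0).
  move=> x0; rewrite oppr_gt0; case: (ltgtP 0 x) => [xp|xn|x00].
  - by rewrite addr0.
  - by rewrite add0r fN.
  - by rewrite -x00 eqxx in x0.
split; first by apply: (itg_ae mf E); exact: itgD.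
rewrite (integ_ae mf _ E); last by meas.
by rewrite integD// -(integ_opp hi); ring.
Qed.

(** The common majorant for Schwartz decay; the value pi normalises the Poisson kernel. *)
Lemma itg_inv_oneDsqr : itg (fun x : R => (1 + x ^+ 2)^-1) /\
  integ (fun x : R => (1 + x ^+ 2)^-1) = pi.
Proof.
have [h1 h2] : itg (fun x : R => if 0 < x then (1 + x ^+ 2)^-1 else 0) /\
    integ (fun x : R => if 0 < x then (1 + x ^+ 2)^-1 else 0) = pi / 2 - atan 0.
  apply: halfline_FTC.
  - by move=> x _; rewrite invr_ge0 ltW// oneD_sqr_gt0.
  - exact: continuous_oneDsqrV.
  - by move=> x; exact: is_derive1_atan.
  - exact: cvgy_atan.
have [||i1 i2] := itg_even _ _ h1.
- by meas.
- by move=> x; rewrite sqrrN.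
by split=> //; rewrite i2 h2 atan0; field.
Qed.

Lemma smooth_has_deriv p : smoothR p -> forall n x,
  has_deriv (derive1n n p) x (derive1n n.+1 p x).
Proof. by move=> sp n x; exact/has_derivP/sp. Qed.

Lemma smooth_continuous p : smoothR p -> forall n, continuous (derive1n n p).
Proof. by move=> sp n x; exact: has_deriv_continuous (smooth_has_deriv sp n x). Qed.

Lemma schwartz_decay p : schwartzR p -> forall n, exists2 C, 0 <= C &
  forall x, `|derive1n n p x| <= C / (1 + x ^+ 2).
Proof.
move=> [_ sp] n; have [M0 h0] := sp 0%N n; have [M2 h2] := sp 2%N n.
exists (M0 + M2).
  by rewrite addr_ge0// ?(le_trans _ (h0 0))// (le_trans _ (h2 0)).
move=> x; rewrite ler_pdivlMr ?oneD_sqr_gt0// mulrDr mulr1 lerD//.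
  by have := h0 x; rewrite expr0 mul1r.
by have := h2 x; rewrite normrM [`|x ^+ 2|]ger0_norm ?sqr_ge0// mulrC.
Qed.

Lemma itg_decay f C : measurable_fun setT f ->
  (forall x, `|f x| <= C / (1 + x ^+ 2)) -> itg f.
Proof.
move=> mf fC; apply: (itg_le mf fC).
by apply: itgZ; exact: itg_inv_oneDsqr.1.
Qed.

Lemma schwartz_itg p : schwartzR p -> forall n, itg (derive1n n p).
Proof.
move=> sp n; have [C _ h] := schwartz_decay sp n; apply: itg_decay h.
by apply: continuous_measurable_fun; exact: smooth_continuous sp.1 n.
Qed.

Lemma schwartz_bounded p : schwartzR p -> forall n, exists2 C, 0 <= C &
  forall x, `|derive1n n p x| <= C.
Proof.
move=> sp n; have [C C0 h] := schwartz_decay sp n; exists C => // x.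
rewrite (le_trans (h x))// ler_pdivrMr ?oneD_sqr_gt0// ler_peMr//.
by rewrite lerDl sqr_ge0.
Qed.

Definition testR p : Prop :=
  smoothR p /\ exists a b : R, 0 < a /\ forall x, (x < a \/ b < x) -> p x = 0.

Lemma has_deriv_locally_zero p x l : (\forall y \near x, p y = 0) ->
  has_deriv p x l -> l = 0.
Proof.
move=> p0 [dp <-]; rewrite -derive1E.
have -> : derive1 p x = derive1 (cst 0 : R -> R) x.
  rewrite !derive1E; apply: near_eq_derive.
  by apply: filterS p0 => y ->.
by rewrite derive1_cst.
Qed.

Lemma test_derive p : testR p -> testR (derive1 p).
Proof.
move=> [sp [a [b [a0 p0]]]]; split.
  by move=> n x; have := sp n.+1 x; rewrite /derive1n iterSr.
exists a, b; split=> // x xab.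
have := smooth_has_deriv sp 0 x; apply: has_deriv_locally_zero.
case: xab => [xa|bx].
  by near=> y; apply: p0; left; near: y; exact: lt_nbhsl.
by near=> y; apply: p0; right; near: y; exact: lt_nbhsr.
Unshelve. all: by end_near. Qed.

Lemma test_derive1n p n : testR p -> testR (derive1n n p).
Proof. by move=> tp; elim: n => // n ih; exact: test_derive. Qed.

Lemma compact_support_bounded f a b : continuous f ->
  (forall x, (x < a \/ b < x) -> f x = 0) -> exists M, forall x, `|f x| <= M.
Proof.
move=> cf f0; have [ab|ba] := leP a b; last first.
  exists 0 => x; rewrite f0 ?normr0//.
  by have [xa|ax] := ltP x a; [left|right; exact: lt_le_trans ax].
have cn : {within `[a, b], continuous (fun x => `|f x|)}.
  by apply: continuous_subspaceT => x; apply: (continuous_comp (cf x)); exact: norm_continuous.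
have [c _ hc] := EVT_max ab cn.
exists `|f c| => x; have [xa|ax] := ltP x a; first by rewrite f0 ?normr0//; left.
have [bx|xb] := ltP b x; first by rewrite f0 ?normr0//; right.
by apply: hc; rewrite in_itv/= ax xb.
Qed.

Lemma test_schwartz p : testR p -> schwartzR p.
Proof.
move=> tp; split; first exact: tp.1.
move=> k n; have [sp [a [b [a0 p0]]]] := test_derive1n n tp.
apply: (@compact_support_bounded _ a b).
  move=> x; apply: cvgM; first exact: exprn_continuous.
  exact: smooth_continuous tp.1 n x.
by move=> x h; rewrite p0// mulr0.
Qed.

Lemma integ_deriv_compact f F a b : continuous f ->
  (forall x, has_deriv F x (f x)) ->
  (forall x, (x < a \/ b < x) -> F x = 0) -> integ f = 0.
Proof.
move=> cf dF F0.
have f0 x : x < a \/ b < x -> f x = 0.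
  move=> xab; have := dF x; apply: has_deriv_locally_zero.
  case: xab => [xa|bx].
    by near=> y; apply: F0; left; near: y; exact: lt_nbhsl.
  by near=> y; apply: F0; right; near: y; exact: lt_nbhsr.
(* The support condition allows b < a; the maximum and the margin 1 give a nondegenerate interval
   with F zero at both ends. *)
pose b' := maxr a b.
have ab1 : a <= b' by rewrite le_max lexx.
have bb1 : b <= b' by rewrite le_max lexx orbT.
have ab' : a - 1 < b' + 1.
  by lra.
have Ea : F (a - 1) = 0 by apply: F0; left; lra.
have Eb : F (b' + 1) = 0.
  by apply: F0; right; lra.
have E : (\int[mu]_(x in `[(a - 1)%R, (b' + 1)%R]%classic) (f x)%:E = 0)%E.
  rewrite (@continuous_FTC2 _ f F)//.
  - by rewrite Ea Eb sube0.
  - exact: continuous_subspaceT.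
  - split.
    + by move=> x _; case: (dF x).
    + by apply: cvg_at_right_filter; exact: has_deriv_continuous (dF _).
    + by apply: cvg_at_left_filter; exact: has_deriv_continuous (dF _).
  - by move=> x _; rewrite derive1E; case: (dF x).
rewrite /integ /Rintegral.
have -> : (\int[mu]_x (f x)%:E = \int[mu]_(x in `[(a - 1)%R, (b' + 1)%R]%classic) (f x)%:E)%E.
  rewrite [RHS]integral_mkcond; apply: eq_integral => x _; rewrite patchE mem_setE in_itv/=.
  case: ifPn => //; rewrite negb_and -!ltNge => /orP[h|h].
    by rewrite f0//; left; lra.
  by rewrite f0//; right; lra.
by rewrite E.
Unshelve. all: by end_near. Qed.

Lemma mean_value f df (a b : R) : a <= b -> (forall x, has_deriv f x (df x)) ->
  exists2 c, a <= c <= b & f b - f a = df c * (b - a).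
Proof.
move=> ab df_; have cf : {within `[a, b], continuous f}.
  by apply: continuous_subspaceT => x; exact: has_deriv_continuous (df_ x).
have [c cab E] := MVT_segment ab (fun x _ => df_ x) cf.
by exists c => //; move: cab; rewrite in_itv.
Qed.

Lemma abs_sin_le (t : R) : `|sin t| <= `|t|.
Proof.
wlog t0 : t / 0 <= t.
  move=> h; have [/h//|t0] := leP 0 t.
  by have := h (- t); rewrite sinN !normrN; apply; rewrite oppr_ge0 ltW.
have [c _] := mean_value t0 (@has_deriv_sin R).
rewrite sin0 !subr0 => ->; rewrite normrM ler_piMl//.
by rewrite ler_norml cos_geN1 cos_le1.
Qed.

Lemma oneBcos_le (t : R) : 2 * (1 - cos t) <= t ^+ 2.
Proof.
have -> : cos t = 1 - 2 * sin (t / 2) ^+ 2.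
  rewrite (_ : t = t / 2 + t / 2); last by field.
  rewrite cosD -!expr2 (_ : (t / 2 + t / 2) / 2 = t / 2); last by field.
  by have := cos2Dsin2 (t / 2); lra.
have h : sin (t / 2) ^+ 2 <= (t / 2) ^+ 2.
  by rewrite -[leLHS]real_normK ?num_real// -[leRHS]real_normK ?num_real//
    lerXn2r ?nnegrE// abs_sin_le.
have -> : t ^+ 2 = 4 * (t / 2) ^+ 2 by field.
by lra.
Qed.

Lemma diff1_bound p (x w C : R) : (forall n y, has_deriv (derive1n n p) y (derive1n n.+1 p y)) ->
  0 <= w -> (forall y, x <= y <= x + w -> `|derive1n 1 p y| <= C) ->
  `|p (x + w) - p x| <= C * w.
Proof.
move=> dp w0 h.
have xw : x <= x + w by rewrite lerDl.
have [c cx ->] := mean_value xw (dp 0%N).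
rewrite normrM (_ : x + w - x = w); last by ring.
by rewrite [`|w|]ger0_norm// ler_wpM2r// h.
Qed.

(** The mean value theorem is applied to the even function p(x + t) + p(x - t), and then to p'
    between x - c and x + c, an interval of length 2 c: hence the factor 2. *)
Lemma diff2_bound p (x w C : R) : (forall n y, has_deriv (derive1n n p) y (derive1n n.+1 p y)) ->
  0 <= w -> (forall y, x - w <= y <= x + w -> `|derive1n 2 p y| <= C) ->
  `|2 * p x - p (x + w) - p (x - w)| <= 2 * C * w ^+ 2.
Proof.
move=> dp w0 h.
pose g t := p (x + t) + p (x - t).
pose dg t := derive1n 1 p (x + t) - derive1n 1 p (x - t).
have dgP t : has_deriv g t (dg t).
  have d1 := dp 0%N (x + t); have d2 := dp 0%N (x - t).
  apply: has_deriv_eq.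
    apply: has_derivD; apply: (@has_deriv_comp _ p).
    - exact: d1.
    - by deriv.
    - exact: d2.
    - by deriv.
  by rewrite /dg; ring.
have [c /andP[c0 cw]] := mean_value w0 dgP; rewrite subr0 => E.
have -> : 2 * p x - p (x + w) - p (x - w) = - (dg c * w).
  by rewrite -E /g addr0 subr0; ring.
have xc : x - c <= x + c by lra.
have [e /andP[e1 e2] E2] := mean_value xc (dp 1%N).
rewrite normrN /dg E2 (_ : x + c - (x - c) = 2 * c); last by ring.
rewrite !normrM (ger0_norm c0) (ger0_norm w0) [`|2|]ger0_norm//.
have he : `|derive1n 2 p e| <= C by apply: h; apply/andP; split; lra.
have C0 : 0 <= C by exact: le_trans he.
rewrite (_ : 2 * C * w ^+ 2 = C * (2 * w) * w); last by ring.
by rewrite ler_wpM2r// ler_pM// ?mulr_ge0// ler_wpM2l.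
Qed.

(** Peetre's inequality; after clearing denominators the difference of the two sides is (x + 2 t)^2
    + 1 + 2 t^2 (x + t)^2. *)
Lemma inv_oneDsqr_shift (x t : R) : (1 + (x + t) ^+ 2)^-1 <= 2 * (1 + t ^+ 2) / (1 + x ^+ 2).
Proof.
rewrite ler_pdivlMr ?oneD_sqr_gt0// mulrC ler_pdivrMr ?oneD_sqr_gt0//.
have h1 := sqr_ge0 (x + 2 * t); have h2 := sqr_ge0 t; have h3 := sqr_ge0 (x + t).
have h4 : 0 <= t ^+ 2 * (x + t) ^+ 2 by rewrite mulr_ge0.
nra.
Qed.

(** The decay in x is kept along with w^2 because these differences are later paired, over all x,
    with a function that is merely bounded. *)
Lemma schwartz_diff2 p : schwartzR p -> exists2 K, 0 <= K & forall x w, 0 <= w ->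
  `|2 * p x - p (x + w) - p (x - w)| <= K * w ^+ 2 / (1 + x ^+ 2).
Proof.
move=> sp; have dp := smooth_has_deriv sp.1.
have [C0 C00 h0] := schwartz_decay sp 0; have [C2 C20 h2] := schwartz_decay sp 2.
(* For w <= 1, [diff2_bound] contributes 2 and the Peetre factor 2 (1 + t^2) at most 4; for w > 1
   the three values of p give C0 (6 + 4 w^2) <= 10 C0 w^2. *)
exists (8 * C2 + 10 * C0) => [|x w w0]; first by rewrite addr_ge0// mulr_ge0.
have x0 := oneD_sqr_gt0 x.
have P t : (1 + (x + t) ^+ 2)^-1 <= 2 * (1 + t ^+ 2) / (1 + x ^+ 2) by exact: inv_oneDsqr_shift.
have [w1|w1] := leP w 1.
  apply: (le_trans (@diff2_bound p x w (C2 * (4 / (1 + x ^+ 2))) dp w0 _)).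
    move=> y /andP[y1 y2]; rewrite (le_trans (h2 y))// ler_wpM2l//.
    rewrite (_ : y = x + (y - x)); last by ring.
    apply: (le_trans (P _)); rewrite ler_wpM2r ?invr_ge0 ?(ltW x0)//.
    have : (y - x) ^+ 2 <= 1.
      by rewrite -[leLHS]real_normK ?num_real// expr_le1// ler_norml; apply/andP; split; lra.
    lra.
  rewrite (_ : 2 * (C2 * (4 / (1 + x ^+ 2))) * w ^+ 2 = (8 * C2) * (w ^+ 2 / (1 + x ^+ 2))); last by ring.
  rewrite -[leRHS]mulrA ler_wpM2r ?divr_ge0 ?sqr_ge0 ?(ltW x0)// lerDl mulr_ge0//.
have w21 : 1 <= w ^+ 2 by rewrite exprn_ege1// ltW.
have hp t : `|p (x + t)| <= C0 * (2 * (1 + t ^+ 2) / (1 + x ^+ 2)).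
  by rewrite (le_trans (h0 _))// ler_wpM2l.
apply: (@le_trans _ _ (2 * (C0 / (1 + x ^+ 2)) + C0 * (2 * (1 + w ^+ 2) / (1 + x ^+ 2)) +
   C0 * (2 * (1 + (- w) ^+ 2) / (1 + x ^+ 2)))).
  rewrite (le_trans (ler_normB _ _))// lerD// (le_trans (ler_normB _ _))// lerD//.
  by rewrite normrM ger0_norm// ler_wpM2l// h0.
rewrite sqrrN (_ : _ + _ + _ = (C0 * (6 + 4 * w ^+ 2)) / (1 + x ^+ 2)); last by ring.
rewrite ler_wpM2r ?invr_ge0 ?(ltW x0)//.
have h8 : 0 <= 8 * C2 * w ^+ 2 by rewrite !mulr_ge0// sqr_ge0.
nra.
Qed.

End Decay.

(** * Fourier inversion *)

Section Fourier.
Variable R : realType.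
Implicit Types (p : R -> R) (th x xi : R).

(* [cos_transform p 0] and [cos_transform p (- pi / 2)] are the cosine and sine
   transforms of [p], recentred at [x]. *)
Definition cos_transform p th x xi : R := integ (fun y => cos (xi * (x - y) + th) * p y).

Lemma cos_norm_le1 (t : R) : `|cos t| <= 1.
Proof. by rewrite ler_norml cos_geN1 cos_le1. Qed.

Lemma itg_cosM p (a b : R) : itg p -> itg (fun y => cos (a * y + b) * p y).
Proof.
move=> ip; apply: itgM_bounded (ip); first by meas.
by move=> y; exact: cos_norm_le1.
Qed.

Lemma itg_cos_kernel p th x xi : itg p -> itg (fun y => cos (xi * (x - y) + th) * p y).
Proof.
move=> ip; apply: (itg_eq _ (itg_cosM (- xi) (xi * x + th) ip)) => y.
by congr (cos _ * _); ring.
Qed.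

Lemma cos_transform_continuous p th x : itg p -> continuous (cos_transform p th x).
Proof.
move=> ip xi; have mp := itg_mf ip.
apply: (@integ_dominated_cvg R (fun xi y => cos (xi * (x - y) + th) * p y) (fun y => `|p y|) xi 0).
- exact: (integrable_abse ip).
- near=> k; split; first by meas.
  by move=> y; rewrite normrM ler_piMl// cos_norm_le1.
- move=> y _; apply: cvgM; last exact: cvg_cst.
  have h : has_deriv (fun k => cos (k * (x - y) + th)) xi
    (- sin (xi * (x - y) + th) * (xi * 0 + (x - y) * 1 + 0)) by deriv.
  exact: has_deriv_continuous h.
Unshelve. all: by end_near. Qed.

Lemma cos_transform_deriv2 p th x xi : testR p ->
  cos_transform (derive1n 2 p) th x xi = - (xi ^+ 2) * cos_transform p th x xi.
Proof.
move=> tp; have sp := test_schwartz tp; have dp := smooth_has_deriv tp.1.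
have i0 := itg_cos_kernel th x xi (schwartz_itg sp 0).
have i2 := itg_cos_kernel th x xi (schwartz_itg sp 2).
have [_ [a [b [_ p0]]]] := tp.
(* F collects the boundary terms of two integrations by parts, and its derivative is f. *)
pose F y := cos (xi * (x - y) + th) * derive1n 1 p y - xi * (sin (xi * (x - y) + th) * p y).
pose f y := cos (xi * (x - y) + th) * derive1n 2 p y + xi ^+ 2 * (cos (xi * (x - y) + th) * p y).
suff : integ f = 0.
  rewrite /f integD//; last exact: itgZ.
  by rewrite integZ// -/(cos_transform _ _ _ _) -/(cos_transform _ _ _ _) => h; lra.
have p1z y : y < a \/ b < y -> derive1n 1 p y = 0.
  move=> yab; have := dp 0%N y; apply: has_deriv_locally_zero.
  case: yab => [ya|yb].
    by near=> z; apply: p0; left; near: z; exact: lt_nbhsl.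
  by near=> z; apply: p0; right; near: z; exact: lt_nbhsr.
apply: (@integ_deriv_compact _ f F a b).
- move=> y; have d0 : has_deriv p y (derive1n 1 p y) := dp 0%N y.
  have d2 := dp 2%N y.
  by apply: (@has_deriv_continuous _ f); rewrite /f; deriv.
- move=> y; have d0 : has_deriv p y (derive1n 1 p y) := dp 0%N y.
  have d1 := dp 1%N y.
  apply: has_deriv_eq; first by rewrite /F; deriv.
  by rewrite /f /=; ring.
- by move=> y yab; rewrite /F p1z// (p0 y yab) !mulr0 subr0.
Unshelve. all: by end_near. Qed.

Lemma cos_transform_le p th x xi : itg p -> `|cos_transform p th x xi| <= integ (fun y => `|p y|).
Proof.
move=> ip; apply: le_norm_integ; first exact: itg_cos_kernel.
  exact: (integrable_abse ip).
by move=> y; rewrite normrM ler_piMl// cos_norm_le1.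
Qed.

(** Here (1 + k)^2 H = H - 2 H2 + H4: with k = xi^2 this is the transform of (1 - d^2/dx^2)^2 p. The
    resulting decay of order xi^-4 leaves room for the symbol, which is at most 1 + xi^2. *)
Lemma le_div_sqr (H H2 H4 n0 n2 n4 k : R) :
  H2 = - k * H -> H4 = - k * H2 -> 0 <= k ->
  `|H| <= n0 -> `|H2| <= n2 -> `|H4| <= n4 ->
  `|H| <= (n0 + 2 * n2 + n4) / (1 + k) ^+ 2.
Proof.
move=> E2 E4 k0 h0 h2 h4; rewrite ler_pdivlMr ?exprn_gt0 ?ltr_wpDr//.
have -> : `|H| * (1 + k) ^+ 2 = `|H - 2 * H2 + H4|.
  rewrite E4 E2 -[(1 + k) ^+ 2]ger0_norm ?sqr_ge0// -normrM.
  by congr `| _ |; ring.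
rewrite (le_trans (ler_normD _ _))// lerD// (le_trans (ler_normB _ _))// lerD//.
by rewrite normrM ger0_norm// ler_wpM2l.
Qed.

Lemma cos_transform_bound p th x : testR p -> exists2 C, 0 <= C & forall xi,
  `|cos_transform p th x xi| <= C / (1 + xi ^+ 2) ^+ 2.
Proof.
move=> tp; have sp := test_schwartz tp.
pose N n := integ (fun y => `|derive1n n p y|).
have N0 n : 0 <= N n by apply: integ_ge0.
exists (N 0%N + 2 * N 2%N + N 4%N); first by rewrite !addr_ge0 ?mulr_ge0.
move=> xi; apply: le_div_sqr (sqr_ge0 xi) _ _ _.
- exact: cos_transform_deriv2 th x xi tp.
- exact: cos_transform_deriv2 th x xi (test_derive1n 2 tp).
- exact: cos_transform_le th x xi (schwartz_itg sp 0).
- exact: cos_transform_le th x xi (schwartz_itg sp 2).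
- exact: cos_transform_le th x xi (schwartz_itg sp 4).
Qed.

Lemma itg_cos_transform p th x : testR p ->
  itg (fun xi => (1 + xi ^+ 2) * cos_transform p th x xi).
Proof.
move=> tp; have [C C0 h] := cos_transform_bound th x tp.
have mH : measurable_fun setT (cos_transform p th x).
  apply: continuous_measurable_fun; apply: cos_transform_continuous.
  exact: schwartz_itg (test_schwartz tp) 0.
apply: (@itg_decay _ _ C); first by meas.
move=> xi; have x0 := oneD_sqr_gt0 xi.
rewrite normrM (gtr0_norm x0) (le_trans (ler_wpM2l (ltW x0) (h xi)))//.
by rewrite le_eqVlt; apply/orP; left; apply/eqP; field; rewrite gt_eqF.
Qed.

Lemma itg_cos_transform_le p th x (s : R -> R) : testR p -> measurable_fun setT s ->
  (forall xi, `|s xi| <= 1 + xi ^+ 2) -> itg (fun xi => s xi * cos_transform p th x xi).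
Proof.
move=> tp ms hs; have i := itg_cos_transform th x tp.
have mH : measurable_fun setT (cos_transform p th x).
  apply: continuous_measurable_fun; apply: cos_transform_continuous.
  exact: schwartz_itg (test_schwartz tp) 0.
apply: (itg_le _ _ (integrable_abse i)); first by meas.
move=> xi; rewrite !normrM (gtr0_norm (oneD_sqr_gt0 xi)).
by rewrite ler_wpM2r.
Qed.

Lemma poisson_kernel (e z : R) : 0 < e ->
  integ (fun xi => expR (- (e * `|xi|)) * cos (xi * z)) = 2 * e / (e ^+ 2 + z ^+ 2).
Proof.
move=> e0.
have ez : e ^+ 2 + z ^+ 2 != 0 by rewrite gt_eqF// ltr_wpDr ?sqr_ge0// exprn_gt0.
have [a1 a2] := halfline_exp e0; have [b1 b2] := halfline_cos z e0.
have E : (fun xi => if 0 < xi then expR (- (e * `|xi|)) * cos (xi * z) else 0) =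
  (fun xi => (if 0 < xi then expR (- (e * xi)) else 0) -
    2^-1 * (if 0 < xi then 2 * (1 - cos (z * xi)) * expR (- (xi * e)) else 0)).
  apply/funext => xi; case: ltP => h; last by rewrite mulr0 subr0.
  by rewrite gtr0_norm// (mulrC xi e) (mulrC xi z); field.
have i : itg (fun xi => if 0 < xi then expR (- (e * `|xi|)) * cos (xi * z) else 0).
  by rewrite E; apply: itgB => //; exact: itgZ.
have [||_ ->] := itg_even _ _ i.
- by meas.
- by move=> x; rewrite normrN mulNr cosN.
rewrite E integB//; last exact: itgZ.
by rewrite integZ// a2 b2; field; rewrite ez gt_eqF.
Qed.

Lemma fourier_inversion p x : testR p -> integ (cos_transform p 0 x) = 2 * pi * p x.
Proof.
move=> tp; have sp := test_schwartz tp; have ip := schwartz_itg sp 0.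
have mp : measurable_fun setT p := itg_mf ip.
have cH := @cos_transform_continuous p 0 x ip.
have mH : measurable_fun setT (cos_transform p 0 x) by exact: continuous_measurable_fun.
have iH : itg (cos_transform p 0 x).
  apply: (itg_eq _ (itg_cos_transform_le 0 x tp (s := fun=> 1) _ _)).
  - by move=> xi; rewrite mul1r.
  - by meas.
  - by move=> xi; rewrite normr1 lerDl sqr_ge0.
(* The absolute value on e keeps the damping factor at most 1 on both sides of 0, since dominated
   convergence is used on a full neighbourhood of e = 0. *)
pose Phi (e : R) := integ (fun xi => expR (- (`|e| * `|xi|)) * cos_transform p 0 x xi).
pose Psi e := integ (fun t => 2 * p (x + e * t) * (1 + t ^+ 2)^-1).
have Phi0 : Phi e @[e --> 0^'+] --> Phi 0.
  apply: cvg_at_right_filter.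
  apply: (@integ_dominated_cvg R (fun e xi => expR (- (`|e| * `|xi|)) * cos_transform p 0 x xi)
    (fun xi => `|cos_transform p 0 x xi|) 0 0).
  - exact: (integrable_abse iH).
  - near=> e; split; first by meas.
    move=> xi; rewrite normrM ler_piMl// ger0_norm ?expR_ge0// expR_le1 oppr_le0.
  - move=> xi _; apply: cvgM; last exact: cvg_cst.
    apply: (@cvg_comp _ _ _ (fun e : R => - (`|e| * `|xi|)) expR); last exact: continuous_expR.
    by apply: cvgN; apply: cvgM; [exact: norm_continuous|exact: cvg_cst].
have [Cb Cb0 hb] := schwartz_bounded sp 0.
have [iq qpi] := @itg_inv_oneDsqr R.
have Psi0 : Psi e @[e --> 0^'+] --> Psi 0.
  apply: cvg_at_right_filter.
  apply: (@integ_dominated_cvg R (fun e t => 2 * p (x + e * t) * (1 + t ^+ 2)^-1)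
    (fun t => 2 * Cb * (1 + t ^+ 2)^-1) 0 0).
  - exact: itgZ.
  - near=> e; split; first by meas.
    move=> t; rewrite normrM (ger0_norm (inv_oneDsqr_ge0 t)).
    rewrite ler_wpM2r ?inv_oneDsqr_ge0// normrM ger0_norm//.
    by rewrite ler_wpM2l// hb.
  - move=> t _.
    have d0 := smooth_has_deriv sp.1 0 (x + 0 * t).
    have h : has_deriv (fun e => 2 * p (x + e * t) * (1 + t ^+ 2)^-1) 0
      (2 * p (x + 0 * t) * 0 + (1 + t ^+ 2)^-1 *
        (2 * (derive1n 1 p (x + 0 * t) * (0 + (0 * 0 + t * 1))) + p (x + 0 * t) * 0)).
      deriv; apply: (@has_deriv_comp _ p (fun e => x + e * t)); first exact: d0.
      by deriv.
    exact: has_deriv_continuous h.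
(* The damping makes Fubini legitimate; integrating in xi first produces the Poisson kernel, and y =
   x + e t rescales it to 1 / (1 + t^2). *)
have PP e : 0 < e -> Phi e = Psi e.
  move=> e0.
  pose F xi y := expR (- (e * `|xi|)) * (cos (xi * (x - y) + 0) * p y).
  have F2 : itg2 F.
    apply: (itg2_le _ _ (itg2_prod (itg_exp_norm e0) (integrable_abse ip))).
      by rewrite /meas2 /F; meas.
    move=> xi y; rewrite !normrM [`|expR _|]ger0_norm ?expR_ge0//.
    by rewrite ler_wpM2l ?expR_ge0// ler_piMl// cos_norm_le1.
  have -> : Phi e = integ (fun xi => integ (F xi)).
    apply: integ_eq => xi; rewrite integZ; last exact: itg_cos_kernel.
    by rewrite (gtr0_norm e0).
  rewrite (integ_swap F2).
  have ik z : itg (fun xi => expR (- (e * `|xi|)) * cos (xi * z)).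
    apply: (itg_le _ _ (itg_exp_norm e0)); first by meas.
    by move=> xi; rewrite normrM ger0_norm ?expR_ge0// ler_piMr ?expR_ge0// cos_norm_le1.
  have Ey y : integ (F^~ y) = p y * (2 * e / (e ^+ 2 + (x - y) ^+ 2)).
    rewrite -poisson_kernel// -integZ//; apply: integ_eq => xi.
    by rewrite /F addr0; ring.
  have iy : itg (fun y => p y * (2 * e / (e ^+ 2 + (x - y) ^+ 2))).
    apply: itg_eq (itg2_integ (itg2_swap F2)).1 => y; exact: Ey.
  rewrite (integ_eq Ey) (integ_affine x e0 iy) -(integZ e (itg_affine x e0 iy)).
  apply: integ_eq => t.
  rewrite (_ : e * t + x = x + e * t); last by ring.
  have t0 := oneD_sqr_gt0 t.
  have h : e ^+ 2 + (x - (x + e * t)) ^+ 2 != 0.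
    rewrite (_ : _ + _ = e ^+ 2 * (1 + t ^+ 2)); last by ring.
    by rewrite gt_eqF// mulr_gt0// exprn_gt0.
  by field; rewrite h gt_eqF.
have : Phi 0 = Psi 0.
  apply: (cvg_unique _ Phi0); rewrite //.
  apply: cvg_trans Psi0; apply: near_eq_cvg; near=> e.
  by rewrite PP//; near: e; exact: nbhs_right_gt.
have -> : Phi 0 = integ (cos_transform p 0 x).
  by apply: integ_eq => xi; rewrite normr0 mul0r oppr0 expR0 mul1r.
move=> ->; rewrite -qpi mulrAC -integZ//.
by apply: integ_eq => t; rewrite mul0r addr0.
Unshelve. all: by end_near. Qed.

Variable alpha : R.
Hypotheses (alpha_gt0 : 0 < alpha) (alpha_lt1 : alpha < 1).
Local Notation m := (mker alpha).

Lemma symb_ge0 xi : 0 <= symb alpha xi.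
Proof. exact: powR_ge0. Qed.

Lemma symb_le xi : symb alpha xi <= 1 + xi ^+ 2.
Proof. by apply: ler1_powR; [rewrite lerDl sqr_ge0|exact: ltW]. Qed.

Lemma measurable_symb : measurable_fun setT (symb alpha).
Proof.
rewrite /symb; apply: (measurable_comp_fun (@measurable_powR R alpha)).
by meas.
Qed.

Lemma itg_symb_cos_transform p th x : testR p ->
  itg (fun xi => symb alpha xi * cos_transform p th x xi).
Proof.
move=> tp; apply: itg_cos_transform_le => //; first exact: measurable_symb.
by move=> xi; rewrite ger0_norm ?symb_ge0// symb_le.
Qed.

Definition diff2 p x w : R := 2 * p x - p (x + w) - p (x - w).

Lemma schwartz_diff2_le p : schwartzR p -> exists2 K, 0 <= K &
  forall x w, 0 <= w -> `|diff2 p x w| <= K * w ^+ 2.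
Proof.
move=> sp; have [K K0 h] := schwartz_diff2 sp; exists K => // x w w0.
rewrite (le_trans (h x w w0))// ler_pdivrMr ?oneD_sqr_gt0//.
by rewrite ler_peMr ?(mulr_ge0 K0 (sqr_ge0 w))// lerDl sqr_ge0.
Qed.

(** Moving the centre x by w or -w adds xi w or -xi w to the phase, and cos (a + b) + cos (a - b) =
    2 cos a cos b. *)
Lemma cos_transform_diff2 p x w xi : itg p ->
  2 * (1 - cos (xi * w)) * cos_transform p 0 x xi =
  2 * cos_transform p 0 x xi - cos_transform p 0 (x + w) xi - cos_transform p 0 (x - w) xi.
Proof.
move=> ip; have i z := itg_cos_kernel 0 z xi ip.
have i2 := itgZ 2 (i x).
rewrite /cos_transform -!integZ// -(integB i2 (i (x + w))).
rewrite -(integB (itgB i2 (i (x + w))) (i (x - w))).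
apply: integ_eq => y; rewrite !addr0.
rewrite (_ : xi * (x + w - y) = xi * (x - y) + xi * w); last by ring.
rewrite (_ : xi * (x - w - y) = xi * (x - y) - xi * w); last by ring.
by rewrite cosD cosB; ring.
Qed.

(** Inserting [symb_mker] gives a double integral in xi and w. As 2 (1 - cos t) <= t^2, it is
    dominated by xi^2 |[cos_transform p 0 x xi]| times w^2 m(w), so Fubini applies; at fixed w,
    inversion is used at x, x + w and x - w. *)
Lemma symb_multiplier p x : testR p ->
  integ (fun xi => symb alpha xi * cos_transform p 0 x xi) =
  2 * pi * (p x + integ (fun w => diff2 p x w * m w)).
Proof.
move=> tp; have sp := test_schwartz tp; have ip := schwartz_itg sp 0.
have mH z : measurable_fun setT (cos_transform p 0 z).
  by apply: continuous_measurable_fun; exact: cos_transform_continuous.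
have mm := measurable_mker alpha.
have m0 := mker_ge0 alpha_gt0 alpha_lt1.
have iH z : itg (cos_transform p 0 z).
  apply: (itg_eq _ (itg_cos_transform_le 0 z tp (s := fun=> 1) _ _)).
  - by move=> xi; rewrite mul1r.
  - by meas.
  - by move=> xi; rewrite normr1 lerDl sqr_ge0.
have iH2 : itg (fun xi => xi ^+ 2 * cos_transform p 0 x xi).
  apply: itg_cos_transform_le => //.
  by move=> xi; rewrite ger0_norm ?sqr_ge0// lerDr.
pose F xi w := cos_transform p 0 x xi * (2 * (1 - cos (xi * w)) * m w).
have mHx := mH x.
have F2 : itg2 F.
  apply: (itg2_le _ _ (itg2_prod (integrable_abse iH2) (itg_sqr_mker alpha_gt0 alpha_lt1))).
    by rewrite /meas2 /F; meas.
  move=> xi w; rewrite /F normrM [X in _ <= X * _]normrM (ger0_norm (sqr_ge0 xi)).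
  have c0 : 0 <= 2 * (1 - cos (xi * w)) by rewrite mulr_ge0// subr_ge0 cos_le1.
  rewrite (ger0_norm (mulr_ge0 c0 (m0 w))).
  rewrite (_ : xi ^+ 2 * _ * _ = `|cos_transform p 0 x xi| * ((xi * w) ^+ 2 * m w)); last by ring.
  by rewrite ler_wpM2l// ler_wpM2r ?m0// oneBcos_le.
have E xi : symb alpha xi * cos_transform p 0 x xi = cos_transform p 0 x xi + integ (F xi).
  have [i1 ->] := symb_mker alpha_gt0 alpha_lt1 xi.
  by rewrite integZ//; ring.
rewrite (integ_eq E) integD//; last exact: (itg2_integ F2).1.
rewrite fourier_inversion// (integ_swap F2) [RHS]mulrDr; congr (_ + _).
have Ew w : integ (F^~ w) = 2 * pi * (diff2 p x w * m w).
  have -> : integ (F^~ w) = integ (fun xi => m w * (2 * cos_transform p 0 x xi -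
    cos_transform p 0 (x + w) xi - cos_transform p 0 (x - w) xi)).
    by apply: integ_eq => xi; rewrite -cos_transform_diff2// /F; ring.
  have iz z := itgZ z (iH x).
  rewrite integZ ?integB ?integZ ?fourier_inversion//; last 2 first.
    by apply: itgB.
    by apply: itgB => //; apply: itgB.
  by rewrite /diff2; ring.
rewrite (integ_eq Ew) integZ//.
have [K K0 hK] := schwartz_diff2_le sp.
have mp : measurable_fun setT p := itg_mf ip.
apply: (itg_le _ _ (itgZ K (itg_sqr_mker alpha_gt0 alpha_lt1))); first by rewrite /diff2; meas.
move=> w; rewrite normrM (ger0_norm (m0 w)) mulrA.
have [w0|w0] := leP w 0; first by rewrite mker_le0// !mulr0.
by rewrite ler_wpM2r ?m0// hK// ltW.
Qed.

End Fourier.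

(** * The integral operator with kernel m *)

Section LevyOperator.
Variables (R : realType) (m : R -> R).
Hypotheses (m_ge0 : forall w, 0 <= m w) (m_le0 : forall w, w <= 0 -> m w = 0).
Hypotheses (mm : measurable_fun setT m) (im2 : itg (fun w => w ^+ 2 * m w)).
Implicit Types (f p q : R -> R).

Lemma itg_sqr_boundM f K : measurable_fun setT f ->
  (forall w, 0 < w -> `|f w| <= K * w ^+ 2) -> itg (fun w => f w * m w).
Proof.
move=> mf h; apply: (itg_le _ _ (itgZ K im2)); first by meas.
move=> w; have [w0|w0] := leP w 0; first by rewrite m_le0// !mulr0 normr0.
by rewrite normrM (ger0_norm (m_ge0 w)) mulrA ler_wpM2r// h.
Qed.

(* By [symb_multiplier], [levy (mker alpha)] is the operator A. *)
Definition levy f x : R := f x + integ (fun w => diff2 f x w * m w).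

(* Since w^2 m(w) is integrable, the bound on [diff2] makes the integral in
   [levy f x] absolutely convergent, uniformly for x away from 0. *)
Definition tame f : Prop := [/\ measurable_fun setT f,
  (exists B, forall x, `|f x| <= B),
  (forall a, 0 < a -> exists2 K, 0 <= K & forall x w, a <= x -> 0 < w ->
     `|diff2 f x w| <= K * w ^+ 2) &
  (forall x, x != 0 -> {for x, continuous f})].

Lemma measurable_diff2 f x : measurable_fun setT f -> measurable_fun setT (diff2 f x).
Proof. by move=> mf; rewrite /diff2; meas. Qed.

Lemma levy_continuous f x : tame f -> 0 < x -> {for x, continuous (levy f)}.
Proof.
move=> [mf _ hK cf] x0.
(* Taking half of x leaves room: one K serves every y near x. *)
have [K K0 h] := hK _ (divr_gt0 x0 (ltr0n _ 2)).
apply: cvgD; first by apply: cf; rewrite gt_eqF.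
apply: (@integ_dominated_cvg R (fun y w => diff2 f y w * m w)
  (fun w => K * (w ^+ 2 * m w)) x x).
- exact: itgZ.
- near=> y; have mfy := measurable_diff2 y mf; split.
    by apply: (@measurable_funM _ _ _ _ (diff2 f y) m).
  move=> w; have [w0|w0] := leP w 0; first by rewrite m_le0// !mulr0 normr0.
  rewrite normrM (ger0_norm (m_ge0 w)) mulrA ler_wpM2r//; apply: h => //.
  by apply: ltW; near: y; apply: lt_nbhsr; rewrite ltr_pdivrMr// ltr_pMr// ltr1n.
(* At w = x the argument x - w meets the possible jump at 0; this single w is the exceptional
   point. *)
- move=> w wx; have [w0|w0] := leP w 0.
    rewrite m_le0// mulr0; apply: cvg_near_cst.
    by near=> y; rewrite mulr0.
  have cvg_shift b : x + b != 0 -> f (y + b) @[y --> x] --> f (x + b).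
    move=> xb; apply: (@cvg_comp _ _ _ (fun y => y + b) f); last exact: cf xb.
    by apply: cvgD; [exact: cvg_id|exact: cvg_cst].
  apply: cvgM; last exact: cvg_cst.
  apply: cvgB; first apply: cvgB.
  + by apply: cvgM; [exact: cvg_cst|apply: cf; rewrite gt_eqF].
  + by apply: cvg_shift; rewrite gt_eqF// addr_gt0.
  + by apply: cvg_shift; rewrite subr_eq0 eq_sym.
Unshelve. all: by end_near. Qed.

Lemma itg2_levy_test f p B : measurable_fun setT f -> (forall x, `|f x| <= B) ->
  schwartzR p -> itg2 (fun x w => f x * (diff2 p x w * m w)).
Proof.
move=> mf fB sp; have [K K0 h] := schwartz_diff2 sp.
have mp : measurable_fun setT p := itg_mf (schwartz_itg sp 0).
have [iq _] := @itg_inv_oneDsqr R.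
apply: (itg2_le _ _ (itg2_prod (itgZ (B * K) iq) im2)).
  by rewrite /meas2 /diff2; meas.
move=> x w; have [w0|w0] := leP w 0; first by rewrite m_le0// !mulr0 normr0.
rewrite !normrM (ger0_norm (m_ge0 w)).
rewrite (_ : B * K / (1 + x ^+ 2) * (w ^+ 2 * m w) =
   B * (K * w ^+ 2 / (1 + x ^+ 2) * m w)); last by ring.
apply: ler_pM => //; first by rewrite mulr_ge0.
by rewrite ler_wpM2r// h// ltW.
Qed.

Lemma itg_diff2_test p x : schwartzR p -> itg (fun w => diff2 p x w * m w).
Proof.
move=> sp; have [K K0 h] := schwartz_diff2_le sp.
have mp : measurable_fun setT p := itg_mf (schwartz_itg sp 0).
apply: (@itg_sqr_boundM _ K); first exact: measurable_diff2.
by move=> w w0; exact: h x w (ltW w0).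
Qed.

Lemma integ_diff2_adjoint f p w B : measurable_fun setT f -> (forall x, `|f x| <= B) ->
  itg p -> integ (fun x => f x * diff2 p x w) = integ (fun x => diff2 f x w * p x).
Proof.
move=> mf fB ip; have mp := itg_mf ip.
have i1 b : itg (fun x => f x * p (x + b)).
  by apply: itgM_bounded (itg_shift b ip).
have i2 b : itg (fun x => f (x + b) * p x).
  by apply: itgM_bounded ip => //; meas.
have s b : integ (fun x => f x * p (x + b)) = integ (fun x => f (x + - b) * p x).
  rewrite (integ_shift (- b) (i1 b)); apply: integ_eq => x.
  by rewrite -addrA [- b + b]addNr addr0.
have i0 : itg (fun x => 2 * (f x * p x)).
  by apply: itgZ; apply: itg_eq (i1 0) => x; rewrite addr0.
transitivity (integ (fun x => 2 * (f x * p x) - f x * p (x + w) - f x * p (x + - w))).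
  by apply: integ_eq => x; rewrite /diff2; ring.
transitivity (integ (fun x => 2 * (f x * p x) - f (x + w) * p x - f (x + - w) * p x)).
  rewrite integB//; last exact: itgB.
  rewrite integB// integB//; last exact: itgB.
  by rewrite integB// !s opprK; ring.
by apply: integ_eq => x; rewrite /diff2; ring.
Qed.

(** Both double integrands are absolutely integrable, for different reasons: [F1] by the decay in x
    of the second differences of p, [F2] because p vanishes below a > 0 and above a those of f are
    O(w^2). At fixed w the claim is translation invariance. *)
Lemma levy_duality f p : tame f -> testR p ->
  [/\ itg (fun x => f x * levy p x), itg (fun x => levy f x * p x) &
      integ (fun x => f x * levy p x) = integ (fun x => levy f x * p x)].
Proof.
move=> [mf [B fB] hK cf] tp; have sp := test_schwartz tp.
have ip : itg p := schwartz_itg sp 0.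
have mp := itg_mf ip.
have [_ [a [b [a0 p0]]]] := tp.
have [K K0 h] := hK a a0.
pose F1 x w := f x * (diff2 p x w * m w).
pose F2 x w := p x * (diff2 f x w * m w).
have iF1 : itg2 F1 by exact: itg2_levy_test fB sp.
have iF2 : itg2 F2.
  apply: (itg2_le _ _ (itg2_prod (integrable_abse ip) (itgZ K im2))).
    by rewrite /meas2 /F2 /diff2; meas.
  move=> x w; have [w0|w0] := leP w 0; first by rewrite /F2 m_le0// !mulr0 normr0.
  have [xa|ax] := ltP x a; first by rewrite /F2 p0 ?mul0r ?normr0 ?mul0r//; left.
  rewrite !normrM (ger0_norm (m_ge0 w)) ler_wpM2l// mulrA ler_wpM2r//.
  exact: h.
have E1 x : f x * levy p x = f x * p x + integ (F1 x).
  by rewrite /levy mulrDr -integZ//; exact: itg_diff2_test.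
have E2 x : levy f x * p x = f x * p x + integ (F2 x).
  rewrite /levy mulrDl (mulrC (integ _)); congr (_ + _).
  have [xa|ax] := ltP x a.
    rewrite p0 ?mul0r; last by left.
    rewrite (integ_eq (g := fun=> 0)) ?integ0// => w.
    by rewrite /F2 p0 ?mul0r//; left.
  rewrite -integZ//; apply: (@itg_sqr_boundM _ K); first exact: measurable_diff2.
  by move=> w w0; exact: h.
have ifp : itg (fun x => f x * p x) by exact: itgM_bounded ip.
have [j1 _] := itg2_integ iF1; have [j2 _] := itg2_integ iF2.
split.
- by apply: (itg_eq _ (itgD ifp j1)) => x; rewrite E1.
- by apply: (itg_eq _ (itgD ifp j2)) => x; rewrite E2.
rewrite (integ_eq E1) (integ_eq E2) (integD ifp j1) (integD ifp j2); congr (_ + _).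
rewrite (integ_swap iF1) (integ_swap iF2); apply: integ_eq => w.
have [w0|w0] := leP w 0.
  by apply: integ_eq => x; rewrite /F1 /F2 m_le0// !mulr0.
have id1 : itg (fun x => f x * diff2 p x w).
  apply: (itgM_bounded mf fB); rewrite /diff2.
  apply: itgB; first apply: itgB; [exact: itgZ|exact: itg_shift|exact: itg_shift].
have id2 : itg (fun x => diff2 f x w * p x).
  apply: (@itgM_bounded _ _ _ (4 * B)) ip; first by rewrite /diff2; meas.
  move=> x; rewrite /diff2.
  rewrite (_ : 4 * B = 2 * B + B + B); last by ring.
  rewrite (le_trans (ler_normB _ _))// lerD// (le_trans (ler_normB _ _))// lerD//.
  by rewrite normrM ger0_norm// ler_wpM2l.
transitivity (m w * integ (fun x => f x * diff2 p x w)).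
  by rewrite -integZ//; apply: integ_eq => x; rewrite /F1; ring.
rewrite (integ_diff2_adjoint w mf fB ip) -integZ//.
by apply: integ_eq => x; rewrite /F2; ring.
Qed.

Lemma continuous_near_cst f (x c : R) : (\forall y \near x, f y = c) -> {for x, continuous f}.
Proof.
move=> h; have -> : f = fun y => f y by [].
by rewrite /prop_for /continuous_at (nbhs_singleton h); exact: cvg_near_cst.
Qed.

(** For w < a <= x all three points are positive, so f has the second difference of p; for w >= a
    the trivial bound 4 B is at most (4 B / a^2) w^2. *)
Lemma tame_half f p B C : measurable_fun setT f -> (forall x, `|f x| <= B) ->
  (forall x, 0 < x -> f x = p x) -> continuous p ->
  (forall x w, 0 < w -> `|diff2 p x w| <= C * w ^+ 2) ->
  (forall x, x < 0 -> {for x, continuous f}) -> tame f.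
Proof.
move=> mf fB fp cp hC cf; split=> //; first by exists B.
- move=> a a0; have B0 : 0 <= B by exact: le_trans (fB 0).
  have C0 : 0 <= C by have := hC 0 1 ltr01; rewrite expr1n mulr1; exact: le_trans.
  have D0 : 0 <= 4 * B / a ^+ 2 by apply: divr_ge0; [exact: mulr_ge0|exact: sqr_ge0].
  exists (C + 4 * B / a ^+ 2); first exact: addr_ge0.
  move=> x w ax w0; have x0 : 0 < x := lt_le_trans a0 ax.
  have [wa|aw] := ltP w a.
    have -> : diff2 f x w = diff2 p x w.
      by rewrite /diff2 !fp// ?subr_gt0 ?addr_gt0// (lt_le_trans wa).
    by rewrite (le_trans (hC x w w0))// ler_wpM2r ?sqr_ge0// lerDl.
  apply: (@le_trans _ _ (4 * B)).
    rewrite /diff2 (_ : 4 * B = 2 * B + B + B); last by ring.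
    rewrite (le_trans (ler_normB _ _))// lerD// (le_trans (ler_normB _ _))// lerD//.
    by rewrite normrM ger0_norm// ler_wpM2l.
  rewrite [leRHS]mulrDl; apply: ler_wpDl; first exact: mulr_ge0 C0 (sqr_ge0 w).
  rewrite -[leRHS]mulrA ler_peMr ?mulr_ge0// mulrC ler_pdivlMr ?exprn_gt0// mul1r.
  by rewrite lerXn2r ?nnegrE// ltW.
- move=> x; rewrite neq_lt => /orP[|x0]; first exact: cf.
  rewrite /prop_for /continuous_at fp//.
  apply: cvg_trans (cp x); apply: near_eq_cvg.
  by near=> y; rewrite fp//; near: y; exact: lt_nbhsr.
Unshelve. all: by end_near. Qed.

Definition half_cut p x : R := if 0 < x then p x else 0.
Definition neg_ind (x : R) : R := if x < 0 then 1 else 0.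

Lemma tame_cut p : schwartzR p -> tame (half_cut p).
Proof.
move=> sp; have [B B0 hB] := schwartz_bounded sp 0.
have [K K0 hK] := schwartz_diff2_le sp.
have mp : measurable_fun setT p := itg_mf (schwartz_itg sp 0).
apply: (@tame_half _ p B K).
- by rewrite /half_cut; meas.
- by move=> x; rewrite /half_cut; case: ifP => _; [exact: hB|rewrite normr0].
- by move=> x x0; rewrite /half_cut x0.
- exact: smooth_continuous sp.1 0%N.
- by move=> x w w0; exact: hK x w (ltW w0).
- move=> x x0; apply: (@continuous_near_cst _ _ 0).
  by near=> y; rewrite /half_cut ltNge ltW//; near: y; exact: lt_nbhsl.
Unshelve. all: by end_near. Qed.

Lemma tame_neg : tame neg_ind.
Proof.
apply: (@tame_half _ (fun=> 0) 1 0).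
- by rewrite /neg_ind; meas.
- by move=> x; rewrite /neg_ind; case: ifP => _; rewrite ?normr1 ?normr0.
- by move=> x x0; rewrite /neg_ind ltNge ltW.
- by move=> x; exact: cvg_cst.
- by move=> x w w0; rewrite /diff2 mulr0 !subr0 normr0 mul0r.
- move=> x x0; apply: (@continuous_near_cst _ _ 1).
  by near=> y; rewrite /neg_ind ifT//; near: y; exact: lt_nbhsl.
Unshelve. all: by end_near. Qed.

(** The points y = x + w and y = x - w at distance w from x, the second counted only while it is
    positive. Pairing them cancels the first-order term when w < x, as in the principal value. *)
Definition pv_diff p x w : R :=
  (p x - p (x + w)) + (if w < x then p x - p (x - w) else 0).

Lemma measurable_pv_diff p x : measurable_fun setT p -> measurable_fun setT (pv_diff p x).
Proof. by move=> mp; rewrite /pv_diff; meas. Qed.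

(** The constant blows up like x^-2 at 0, which is harmless for the pointwise formula;
    [pv_diff_form_bound] is the estimate uniform in x. *)
Lemma pv_diff_bound p x : schwartzR p -> 0 < x -> exists2 K, 0 <= K &
  forall w, 0 < w -> `|pv_diff p x w| <= K * w ^+ 2.
Proof.
move=> sp x0; have [B B0 hB] := schwartz_bounded sp 0.
have [K K0 hK] := schwartz_diff2_le sp.
have D0 : 0 <= 2 * B / x ^+ 2 by apply: divr_ge0; [exact: mulr_ge0|exact: sqr_ge0].
exists (K + 2 * B / x ^+ 2); first exact: addr_ge0.
move=> w w0; rewrite /pv_diff; case: ltP => [wx|xw].
  rewrite (_ : p x - p (x + w) + (p x - p (x - w)) = diff2 p x w); last by rewrite /diff2; ring.
  by rewrite (le_trans (hK x w (ltW w0)))// ler_wpM2r ?sqr_ge0// lerDl.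
rewrite addr0; apply: (@le_trans _ _ (2 * B)).
  rewrite (_ : 2 * B = B + B); last by ring.
  by rewrite (le_trans (ler_normB _ _))// lerD// hB.
rewrite [leRHS]mulrDl; apply: ler_wpDl; first exact: mulr_ge0 K0 (sqr_ge0 w).
rewrite -[leRHS]mulrA ler_peMr ?mulr_ge0// mulrC ler_pdivlMr ?exprn_gt0// mul1r.
by rewrite lerXn2r ?nnegrE// ltW.
Qed.

Lemma itg_pv_diff p x : schwartzR p -> 0 < x -> itg (fun w => pv_diff p x w * m w).
Proof.
move=> sp x0; have [K K0 hK] := pv_diff_bound sp x0.
apply: (itg_sqr_boundM _ hK); apply: measurable_pv_diff.
exact: itg_mf (schwartz_itg sp 0).
Qed.

(** For w < x the second difference of [neg_ind] is 0 and that of [half_cut p] is the one of p; for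
    w > x they add up to p x - p (x + w). Only w = x is exceptional. *)
Lemma levy_cut p x : schwartzR p -> 0 < x ->
  levy (half_cut p) x + p x * levy neg_ind x = p x + integ (fun w => pv_diff p x w * m w).
Proof.
move=> sp x0.
have it f : tame f -> itg (fun w => diff2 f x w * m w).
  move=> [mf _ hK _]; have [K K0 h] := hK x x0.
  by apply: (@itg_sqr_boundM _ K); [exact: measurable_diff2|move=> w; exact: h].
have i1 := it _ (tame_cut sp); have i2 := it _ tame_neg.
have mp : measurable_fun setT p := itg_mf (schwartz_itg sp 0).
rewrite /levy {1}/half_cut x0 {1}/neg_ind (ltNge x 0) (ltW x0)/= add0r -addrA.
rewrite -integZ// -integD//; last exact: itgZ.
congr (_ + _); apply: (@integ_ae _ _ _ x).
- by rewrite /diff2 /half_cut /neg_ind; meas.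
- by rewrite /pv_diff; meas.
move=> w wx; have [w0|w0] := leP w 0; first by rewrite m_le0// !mulr0 addr0.
rewrite mulrA -mulrDl; congr (_ * _).
rewrite /diff2 /half_cut /neg_ind /pv_diff x0 (addr_gt0 x0 w0) (ltNge (x + w)) (ltW (addr_gt0 x0 w0))/=.
rewrite (ltNge x 0) (ltW x0)/= subr_gt0 subr_lt0.
case: (ltgtP w x) => [_|_|E]; last by rewrite E eqxx in wx.
  by ring.
by ring.
Qed.

(** As [h] vanishes on nonpositive arguments, its value at |x - y| is h (y - x) + h (x - y); the
    substitutions y = x + w and y = x - w bring both terms to the variable w. *)
Lemma integ_split_abs (k h : R -> R) B x : measurable_fun setT k ->
  (forall y, `|k y| <= B) -> itg h -> (forall w, w <= 0 -> h w = 0) ->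
  itg (fun y => k y * h `|x - y|) /\
  integ (fun y => k y * h `|x - y|) = integ (fun w => (k (x + w) + k (x - w)) * h w).
Proof.
move=> mk kB ih h0; have mh := itg_mf ih.
have E y : k y * h `|x - y| = k y * h (y - x) + k y * h (x - y).
  have [xy|yx] := leP x y.
    by rewrite (h0 (x - y)) ?subr_le0// mulr0 addr0 ler0_norm ?subr_le0// opprB.
  by rewrite (h0 (y - x)) ?subr_le0 ?ltW// mulr0 add0r gtr0_norm ?subr_gt0.
have i1 : itg (fun y => k y * h (y - x)) by exact: itgM_bounded (itg_shift (- x) ih).
have i2 : itg (fun y => k y * h (x - y)).
  apply: (itgM_bounded mk kB); apply: (itg_eq _ (itg_opp (itg_shift x ih))) => y.
  by rewrite addrC.
split; first by apply: itg_eq (itgD i1 i2) => y; rewrite E.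
rewrite (integ_eq E) integD// (integ_shift x i1) (integ_opp i2).
rewrite (integ_shift (- x) (itg_opp i2)) -integD.
- apply: integ_eq => w; rewrite addrK opprB (_ : x - (x - w) = w); last by ring.
  by rewrite (addrC w x); ring.
- exact: itg_shift i1.
- exact: (itg_shift (- x) (itg_opp i2)).
Qed.

Lemma pv_integral p x eps : schwartzR p -> 0 < x -> 0 < eps ->
  itg (fun y => (if 0 < y then p x - p y else 0) * (chi_eps eps `|x - y| * m `|x - y|)) /\
  integ (fun y => (if 0 < y then p x - p y else 0) * (chi_eps eps `|x - y| * m `|x - y|))
  = integ (fun w => chi_eps eps w * (pv_diff p x w * m w)).
Proof.
move=> sp x0 e0; have [B B0 hB] := schwartz_bounded sp 0.
have mp : measurable_fun setT p := itg_mf (schwartz_itg sp 0).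
pose h w := chi_eps eps w * m w.
have mchi : measurable_fun setT (chi_eps eps) by rewrite /chi_eps; meas.
have ih : itg h.
  (* On w > eps one has 1 <= w^2 / eps^2, so the truncated kernel is integrable. *)
  apply: (@itg_sqr_boundM (chi_eps eps) (eps ^- 2)) => // w w0; rewrite /chi_eps.
  case: ltP => ew; last by rewrite normr0 mulr_ge0 ?sqr_ge0// invr_ge0 sqr_ge0.
  rewrite normr1 mulrC ler_pdivlMr ?exprn_gt0// mul1r.
  by rewrite lerXn2r ?nnegrE// ltW.
have h0 w : w <= 0 -> h w = 0 by move=> w0; rewrite /h m_le0// mulr0.
pose k y := if 0 < y then p x - p y else 0.
have mk : measurable_fun setT k by rewrite /k; meas.
have kB y : `|k y| <= B + B.
  rewrite /k; case: ifP => _; last by rewrite normr0 addr_ge0.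
  by rewrite (le_trans (ler_normB _ _))// lerD// hB.
have [i1 i2] := integ_split_abs x mk kB ih h0.
split=> //; rewrite i2; apply: integ_eq => w.
have [w0|w0] := leP w 0; first by rewrite h0// m_le0// !mulr0.
rewrite /k (addr_gt0 x0 w0) subr_gt0 /h /pv_diff.
by case: ifP => _; ring.
Qed.

(** Once paired, the integrand is absolutely integrable, and the truncation is removed by dominated
    convergence. The limit is written as the value at eps = 0, where [chi_eps] is 1 on w > 0. *)
Lemma pv_limit p x : schwartzR p -> 0 < x ->
  integ (fun w => chi_eps eps w * (pv_diff p x w * m w)) @[eps --> 0^'+] -->
  integ (fun w => pv_diff p x w * m w).
Proof.
move=> sp x0; have i := itg_pv_diff sp x0.
have mp : measurable_fun setT p := itg_mf (schwartz_itg sp 0).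
have -> : integ (fun w => pv_diff p x w * m w) =
    integ (fun w => chi_eps 0 w * (pv_diff p x w * m w)).
  apply: integ_eq => w; rewrite /chi_eps; case: ltP; first by rewrite mul1r.
  by move=> w0; rewrite m_le0// !mulr0.
apply: cvg_at_right_filter.
apply: (@integ_dominated_cvg R (fun eps w => chi_eps eps w * (pv_diff p x w * m w))
  (fun w => `|pv_diff p x w * m w|) 0 0).
- exact: (integrable_abse i).
- near=> eps; split; first by rewrite /chi_eps /pv_diff; meas.
  move=> w; rewrite normrM ler_piMl// /chi_eps.
  by case: ifP; rewrite ?normr1 ?normr0.
- move=> w wn0; have [w0|w0] := leP w 0.
    by rewrite m_le0// !mulr0; apply: cvg_near_cst; near=> e; rewrite !mulr0.
  apply: cvgM; last exact: cvg_cst.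
  apply: (@continuous_near_cst (fun e => chi_eps e w) 0 1).
  by near=> e; rewrite /chi_eps ifT//; near: e; exact: lt_nbhsl.
Unshelve. all: by end_near. Qed.

End LevyOperator.

(** * The quadratic form *)

Section Energy.
Variables (R : realType) (m : R -> R).
Hypotheses (m_ge0 : forall w, 0 <= m w) (m_le0 : forall w, w <= 0 -> m w = 0).
Hypotheses (mm : measurable_fun setT m) (im2 : itg (fun w => w ^+ 2 * m w)).
Local Notation mu := (@lebesgue_measure R).
Implicit Types (p q : R -> R) (F G : R -> R -> R).

Definition integ2 F : R := fine (\int[mu \x mu]_z (F z.1 z.2)%:E)%E.

Lemma integ2D F G : itg2 F -> itg2 G -> integ2 (fun x y => F x y + G x y) = integ2 F + integ2 G.
Proof.
move=> iF iG; exact: (@RintegralD _ _ _ (mu \x mu)%E setT (fun z => F z.1 z.2) (fun z => G z.1 z.2)).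
Qed.

Lemma integ2E F : itg2 F -> integ (fun x => integ (F x)) = integ2 F.
Proof. by move=> /itg2_integ[]. Qed.

Lemma integ2_swap F : itg2 F -> integ2 (fun x y => F y x) = integ2 F.
Proof.
move=> iF; rewrite -(integ2E (itg2_swap iF)) -(integ2E iF).
by rewrite (integ_swap iF).
Qed.

(* The form density after the substitution y = x + w. *)
Definition form_density p q x w : R :=
  if 0 < x then (p (x + w) - p x) * (q (x + w) - q x) * m w else 0.

Lemma meas2_form_density p q : measurable_fun setT p -> measurable_fun setT q ->
  meas2 (form_density p q).
Proof. by move=> mp mq; rewrite /meas2 /form_density; meas. Qed.

(** For x >= 0 the derivative bound C / (1 + y^2) is largest at the left end y = x, so the decay in
    x holds for all w. In [form_density] one increment uses the decaying bound and the other the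
    plain one. *)
Lemma schwartz_diff1 p : schwartzR p -> exists2 C, 0 <= C & forall x w, 0 <= x -> 0 <= w ->
  `|p (x + w) - p x| <= C * w / (1 + x ^+ 2) /\ `|p (x + w) - p x| <= C * w.
Proof.
move=> sp; have [C C0 h] := schwartz_decay sp 1; exists C => // x w x0 w0.
have key : `|p (x + w) - p x| <= C / (1 + x ^+ 2) * w.
  apply: (diff1_bound (smooth_has_deriv sp.1) w0) => y /andP[xy _].
  rewrite (le_trans (h y))// ler_wpM2l// lef_pV2 ?posrE ?oneD_sqr_gt0// lerD2l.
  by rewrite lerXn2r ?nnegrE// (le_trans x0).
split; first by rewrite mulrAC.
rewrite (le_trans key)// ler_wpM2r// ler_pdivrMr ?oneD_sqr_gt0// ler_peMr//.
by rewrite lerDl sqr_ge0.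
Qed.

Lemma form_density_bound p q : schwartzR p -> schwartzR q -> exists2 C, 0 <= C &
  forall x w, `|form_density p q x w| <= C / (1 + x ^+ 2) * (w ^+ 2 * m w).
Proof.
move=> sp sq; have [C C0 hp] := schwartz_diff1 sp; have [D D0 hq] := schwartz_diff1 sq.
exists (C * D); first exact: mulr_ge0.
move=> x w; rewrite /form_density.
have rhs0 : 0 <= C * D / (1 + x ^+ 2) * (w ^+ 2 * m w).
  by rewrite mulr_ge0 ?(mulr_ge0 (sqr_ge0 w))// mulr_ge0 ?(mulr_ge0 C0)// inv_oneDsqr_ge0.
case: ltP => [x0|_]; last by rewrite normr0.
have [w0|w0] := leP w 0; first by rewrite m_le0// !mulr0 normr0.
have [h1 _] := hp x w (ltW x0) (ltW w0); have [_ h2] := hq x w (ltW x0) (ltW w0).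
rewrite !normrM (ger0_norm (m_ge0 w)).
rewrite (_ : C * D / (1 + x ^+ 2) * (w ^+ 2 * m w) =
  C * w / (1 + x ^+ 2) * (D * w) * m w); last by ring.
by rewrite ler_wpM2r// ler_pM.
Qed.

Lemma itg2_form_density p q : schwartzR p -> schwartzR q -> itg2 (form_density p q).
Proof.
move=> sp sq; have [C C0 h] := form_density_bound sp sq.
apply: (itg2_le _ h (itg2_prod (itgZ C (itg_inv_oneDsqr R).1) im2)).
apply: meas2_form_density; exact: itg_mf (schwartz_itg _ 0).
Qed.

Lemma itg_form_density p q x : schwartzR p -> schwartzR q -> itg (form_density p q x).
Proof.
move=> sp sq; have [C C0 h] := form_density_bound sp sq.
apply: (itg_le _ (h x) (itgZ _ im2)); apply: meas2_l.
apply: meas2_form_density; exact: itg_mf (schwartz_itg _ 0).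
Qed.

(* [|pv_diff|] is only O(w) for w >= x, and the region 0 < x <= w contributes
   the extra power of w when x is integrated first. *)
Lemma itg2_triangle : itg2 (fun x w => if (0 < x) && (x <= w) then w * m w else 0).
Proof.
have mT : meas2 (fun x w : R => if (0 < x) && (x <= w) then w * m w else 0).
  rewrite /meas2; apply: (@measurable_fun_ifT _ _ _ _ (fun z : R * R => z.2 * m z.2)
    (fun=> 0) (fun z => (0 < z.1) && (z.1 <= z.2))).
  - by apply: measurable_and; meas.
  - by meas.
  - by meas.
apply/integrable21ltyP; first exact/measurable_EFinP.
have -> : (fun w : R => \int[mu]_x `|(if (0 < (x, w).1) && ((x, w).1 <= (x, w).2)
    then (x, w).2 * m (x, w).2 else 0)%:E|)%E = (fun w => (w ^+ 2 * m w)%:E).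
  apply/funext => w; have [w0|w0] := leP w 0.
    rewrite m_le0// mulr0; apply: integral0_eq => x _ /=.
    by rewrite mulr0; case: ifP; rewrite normr0.
  transitivity (\int[mu]_(x in `]0%R, w]) (w * m w)%:E)%E.
    rewrite [RHS]integral_mkcond; apply: eq_integral => x _.
    rewrite patchE mem_setE in_itv/=; case: ifP => _; last by rewrite normr0.
    by rewrite ger0_norm// mulr_ge0// ltW.
  rewrite integral_cst//= lebesgue_measure_itv/= lte_fin w0 -EFinB subr0 -EFinM.
  by congr EFin; ring.
exact: integrable_lty im2.
Qed.

Lemma pv_diff_form_bound p : schwartzR p -> exists2 C, 0 <= C & forall x w, 0 < x -> 0 < w ->
  `|pv_diff p x w| <= C * w ^+ 2 + C * (if x <= w then w else 0).
Proof.
move=> sp; have [K K0 hK] := schwartz_diff2_le sp.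
have [C C0 hp] := schwartz_diff1 sp.
exists (K + C); first exact: addr_ge0.
move=> x w x0 w0; rewrite /pv_diff; case: ltP => [wx|xw].
  rewrite mulr0 addr0 (_ : p x - p (x + w) + (p x - p (x - w)) = diff2 p x w); last by rewrite /diff2; ring.
  by rewrite (le_trans (hK x w (ltW w0)))// ler_wpM2r ?sqr_ge0// lerDl.
have [_ h] := hp x w (ltW x0) (ltW w0).
rewrite addr0 distrC (le_trans h)//; apply: ler_wpDl.
  by rewrite mulr_ge0 ?sqr_ge0// addr_ge0.
by rewrite ler_wpM2r ?(ltW w0)// lerDr.
Qed.

Lemma itg2_pv_form p q : schwartzR p -> schwartzR q ->
  itg2 (fun x w => if 0 < x then q x * (pv_diff p x w * m w) else 0).
Proof.
move=> sp sq; have [C C0 h] := pv_diff_form_bound sp.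
have [B B0 hB] := schwartz_bounded sq 0.
have iq : itg q := schwartz_itg sq 0.
have mp : measurable_fun setT p := itg_mf (schwartz_itg sp 0).
have mq := itg_mf iq.
have i1 := itg2_prod (itgZ C (integrable_abse iq)) im2.
have i2 : itg2 (fun x w => B * C * (if (0 < x) && (x <= w) then w * m w else 0)).
  exact: (integrableZl _ (B * C) itg2_triangle).
apply: (itg2_le _ _ (itg2D i1 i2)); first by rewrite /meas2 /pv_diff; meas.
move=> x w.
have T0 : 0 <= (if (0 < x) && (x <= w) then w * m w else 0).
  case: ifP => // /andP[x0 xw]; rewrite mulr_ge0// ltW//; exact: lt_le_trans xw.
have rhs0 : 0 <= C * `|q x| * (w ^+ 2 * m w) + B * C * (if (0 < x) && (x <= w) then w * m w else 0).
  by rewrite addr_ge0// mulr_ge0 ?(mulr_ge0 C0)// ?(mulr_ge0 B0)// (mulr_ge0 (sqr_ge0 w)).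
case: ltP rhs0 T0 => [x0 rhs0 T0|_ rhs0 _]; last by rewrite normr0.
have [w0|w0] := leP w 0; first by rewrite m_le0// !mulr0 normr0 if_same mulr0 addr0.
rewrite /= !normrM (ger0_norm (m_ge0 w)).
apply: (@le_trans _ _ (`|q x| * ((C * w ^+ 2 + C * (if x <= w then w else 0)) * m w))).
  by rewrite ler_wpM2l// ler_wpM2r// h.
rewrite mulrDl mulrDr lerD//.
  by rewrite le_eqVlt; apply/orP; left; apply/eqP; ring.
case: ifP => xw; last by rewrite mulr0 mul0r !mulr0.
rewrite (_ : `|q x| * (C * w * m w) = `|q x| * (C * (w * m w))); last by ring.
rewrite -[leRHS]mulrA ler_wpM2r// ?mulr_ge0 ?(ltW w0)//.
Qed.

(** Fubini is applied to the paired difference as a whole; the pieces [u] and [v] are formed only at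
    fixed w, since each alone is of first order in w and only w^2 m(w) is assumed integrable. *)
Lemma energy_form p q : schwartzR p -> schwartzR q ->
  itg (fun x => if 0 < x then integ (fun w => pv_diff p x w * m w) * q x else 0) /\
  integ (fun x => if 0 < x then integ (fun w => pv_diff p x w * m w) * q x else 0) =
  integ2 (form_density p q).
Proof.
move=> sp sq; have iG := itg2_pv_form sp sq; have iD := itg2_form_density sp sq.
have ip : itg p := schwartz_itg sp 0; have iq : itg q := schwartz_itg sq 0.
have mp := itg_mf ip; have mq := itg_mf iq.
set G := (fun x w => if _ then _ else _) in iG.
have E x : (if 0 < x then integ (fun w => pv_diff p x w * m w) * q x else 0) = integ (G x).
  rewrite /G; case: ifPn => x0; last by rewrite integ0.
  have i : itg (fun w => pv_diff p x w * m w) by exact: itg_pv_diff.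
  by rewrite (integZ (q x) i) mulrC.
split; first by apply: (itg_eq _ (itg2_integ iG).1) => x; rewrite E.
rewrite (integ_eq E) -(integ2E iD) (integ_swap iG) (integ_swap iD).
apply: integ_eq => w; have [w0|w0] := leP w 0.
  by apply: integ_eq => x; rewrite /G /form_density m_le0// !mulr0.
have [Bp Bp0 hp] := schwartz_bounded sp 0.
pose u x := if 0 < x then p x - p (x + w) else 0.
pose v x := if w < x then p x - p (x - w) else 0.
have uB x : `|u x| <= Bp + Bp.
  rewrite /u; case: ifP => _; last by rewrite normr0 addr_ge0.
  by rewrite (le_trans (ler_normB _ _))// lerD// hp.
have vB x : `|v x| <= Bp + Bp.
  rewrite /v; case: ifP => _; last by rewrite normr0 addr_ge0.
  by rewrite (le_trans (ler_normB _ _))// lerD// hp.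
have mu_ : measurable_fun setT u by rewrite /u; meas.
have mv : measurable_fun setT v by rewrite /v; meas.
have iu := itgM_bounded mu_ uB iq; have iv := itgM_bounded mv vB iq.
transitivity (m w * integ (fun x => u x * q x + v x * q x)).
  rewrite -integZ; last exact: itgD.
  apply: integ_eq => x; rewrite /G /u /v /pv_diff; case: (ltP 0 x) => x0.
    by case: ifP => _; ring.
  by rewrite ltNge (le_trans x0 (ltW w0))/=; ring.
(* The shift by w turns v x * q x into (p (x + w) - p x) * q (x + w) on x > 0, which completes u x *
   q x to the product of increments. *)
rewrite integD// (integ_shift w iv) -integD//; last exact: itg_shift iv.
rewrite -integZ; last by apply: itgD => //; exact: itg_shift iv.
apply: integ_eq => x; rewrite /u /v /form_density addrK ltrDr.
by case: ifP => _; ring.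
Qed.

(** [m] vanishes on nonpositive arguments, so the integrand is [F1 x y] where y > x and its
    transpose where x > y; there the smaller variable being positive makes the other positive. The
    halves have equal integrals, hence the 2, and y = x + w turns each into the form. *)
Lemma double_integral p : schwartzR p ->
  let F x y := if (0 < x) && (0 < y) then (p x - p y) ^+ 2 * m `|x - y| else 0 in
  itg2 F /\ integ2 F = 2 * integ2 (form_density p p).
Proof.
move=> sp F; have iD := itg2_form_density sp sp.
have mp : measurable_fun setT p := itg_mf (schwartz_itg sp 0).
have mD := meas2_form_density mp mp.
pose F1 x y := form_density p p x (y - x).
have mF1 : meas2 F1 by rewrite /meas2 /F1 /form_density; meas.
have iF1 : itg2 F1.
  apply/integrable12ltyP; first exact/measurable_EFinP.
  have /integrable12ltyP := iD; move=> /(_ ((measurable_EFinP _ _).2 mD)).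
  rewrite (_ : (fun x => \int[mu]_y _)%E = (fun x : R => \int[mu]_y `|(F1 (x, y).1 (x, y).2)%:E|)%E)//.
  apply/funext => x; rewrite (@ge0_integral_affine _ 1 (- x)) ?ltr01//=.
  - rewrite mul1e; apply: eq_integral => y _.
    by rewrite /F1 mul1r.
  - apply/measurable_EFinP; apply: (measurable_comp_fun (@normr_measurable R setT)).
    exact: meas2_l mD.
have iF2 := itg2_swap iF1.
have FE : F = (fun x y => F1 x y + F1 y x).
  apply/funext => x; apply/funext => y; rewrite /F /F1 /form_density.
  rewrite (_ : x + (y - x) = y); last by ring.
  rewrite (_ : y + (x - y) = x); last by ring.
  have [x0|x0] := ltP 0 x; have [y0|y0] := ltP 0 y; rewrite /= ?addr0 ?add0r//.
  - have [xy|yx] := leP x y.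
      rewrite (m_le0 (w := x - y)) ?subr_le0// mulr0 addr0.
      by rewrite ler0_norm ?subr_le0// opprB; ring.
    rewrite (m_le0 (w := y - x)) ?subr_le0 ?(ltW yx)// mulr0 add0r.
    by rewrite gtr0_norm ?subr_gt0//; ring.
  - by rewrite m_le0 ?mulr0// subr_le0 (le_trans y0 (ltW x0)).
  - by rewrite m_le0 ?mulr0// subr_le0 (le_trans x0 (ltW y0)).
have E1 : integ2 F1 = integ2 (form_density p p).
  rewrite -(integ2E iF1) -(integ2E iD); apply: integ_eq => x.
  by rewrite (integ_shift (- x) (itg_form_density x sp sp)).
split; first by rewrite FE; exact: itg2D.
by rewrite FE integ2D// (integ2_swap iF1) E1; ring.
Qed.

End Energy.

(** * The transpose of A *)

Section ComplexParts.
Variable R : realType.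
Local Notation C := (complex R).
Implicit Types (z w : C) (a : R).

Lemma complex_ext z w : cre z = cre w -> cim z = cim w -> z = w.
Proof. by case: z w => a b [c d] /= -> ->. Qed.

Lemma creM z w : cre (z * w) = cre z * cre w - cim z * cim w.
Proof. by case: z w => a b [c d]. Qed.

Lemma cimM z w : cim (z * w) = cre z * cim w + cim z * cre w.
Proof. by case: z w => a b [c d]. Qed.

Lemma creD z w : cre (z + w) = cre z + cre w.
Proof. by case: z w => a b [c d]. Qed.

Lemma cimD z w : cim (z + w) = cim z + cim w.
Proof. by case: z w => a b [c d]. Qed.

Lemma creB z w : cre (z - w) = cre z - cre w.
Proof. by case: z w => a b [c d]. Qed.

Lemma cimB z w : cim (z - w) = cim z - cim w.
Proof. by case: z w => a b [c d]. Qed.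

Lemma cre_cofRM a z : cre (cofR a * z) = a * cre z.
Proof. by rewrite creM /= mul0r subr0. Qed.

Lemma cim_cofRM a z : cim (cofR a * z) = a * cim z.
Proof. by rewrite cimM /= mul0r addr0. Qed.

Lemma cre_Cint D (f : R -> C) : cre (Cint D f) = Rintegral (@lebesgue_measure R) D (fun x => cre (f x)).
Proof. by []. Qed.

Lemma cim_Cint D (f : R -> C) : cim (Cint D f) = Rintegral (@lebesgue_measure R) D (fun x => cim (f x)).
Proof. by []. Qed.

End ComplexParts.

Section Transpose.
Variables (R : realType) (alpha : R).
Hypotheses (alpha_gt0 : 0 < alpha) (alpha_lt1 : alpha < 1).
Local Notation C := (complex R).
Local Notation m := (mker alpha).

Lemma test_cre (phi : R -> C) : test_pos phi -> testR (fun x => cre (phi x)).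
Proof.
move=> [sp [_ [a [b [a0 h]]]]]; split=> //.
by exists a, b; split=> // x /h ->.
Qed.

Lemma test_cim (phi : R -> C) : test_pos phi -> testR (fun x => cim (phi x)).
Proof.
move=> [_ [sp [a [b [a0 h]]]]]; split=> //.
by exists a, b; split=> // x /h ->.
Qed.

Lemma itg_sinM p (a b : R) : itg p -> itg (fun y : R => sin (a * y + b) * p y).
Proof.
move=> ip; apply: (@itgM_bounded _ _ _ 1) (ip); first by meas.
by move=> y; rewrite ler_norml sin_geN1 sin_le1.
Qed.

Definition root2pi_inv : R := (Num.sqrt (2 * pi))^-1.

Lemma root2pi_inv_sqr : root2pi_inv * root2pi_inv = (2 * pi)^-1.
Proof.
rewrite /root2pi_inv -invfM; congr (_ ^-1).
by rewrite -expr2 sqr_sqrtr// mulr_ge0// pi_ge0.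
Qed.

Lemma cre_fourier_inv (phi : R -> C) xi : cre (fourier_inv phi xi) =
  root2pi_inv * integ (fun y => cos (xi * y) * cre (phi y) + sin (xi * y) * cim (phi y)).
Proof.
rewrite cre_cofRM; congr (_ * _); apply: integ_eq => y.
by rewrite creM /= cosN sinN (mulrC y) mulNr opprK.
Qed.

Lemma cim_fourier_inv (phi : R -> C) xi : cim (fourier_inv phi xi) =
  root2pi_inv * integ (fun y => cos (xi * y) * cim (phi y) - sin (xi * y) * cre (phi y)).
Proof.
rewrite cim_cofRM; congr (_ * _); apply: integ_eq => y.
by rewrite cimM /= cosN sinN (mulrC y) mulNr.
Qed.

(** This is the real part of the integral of e^(i xi (x - y)) (p + i q)(y) dy; the phase - pi / 2
    turns cosine into sine, so both terms are instances of [cos_transform]. *)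
Lemma fourier_cross_re p q x xi : itg p -> itg q ->
  cos (x * xi) * integ (fun y : R => cos (xi * y) * p y + sin (xi * y) * q y) -
  sin (x * xi) * integ (fun y => cos (xi * y) * q y - sin (xi * y) * p y) =
  cos_transform p 0 x xi - cos_transform q (- (pi / 2)) x xi.
Proof.
move=> ip iq.
have ic f : itg f -> itg (fun y => cos (xi * y) * f y).
  by move=> h; apply: itg_eq (itg_cosM xi 0 h) => y; rewrite addr0.
have isn f : itg f -> itg (fun y => sin (xi * y) * f y).
  by move=> h; apply: itg_eq (itg_sinM xi 0 h) => y; rewrite addr0.
have i1 := itgD (ic _ ip) (isn _ iq); have i2 := itgB (ic _ iq) (isn _ ip).
rewrite -(integZ _ i1) -(integZ _ i2) -(integB (itgZ _ i1) (itgZ _ i2)).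
rewrite -(integB (itg_cos_kernel _ _ _ ip) (itg_cos_kernel _ _ _ iq)).
apply: integ_eq => y; rewrite addr0 (_ : xi * (x - y) = x * xi - xi * y); last by ring.
rewrite [cos (_ - pi / 2)]cosB cos_pihalf sin_pihalf mulr0 mulr1 add0r cosB sinB.
by ring.
Qed.

Lemma fourier_cross_im p q x xi : itg p -> itg q ->
  cos (x * xi) * integ (fun y : R => cos (xi * y) * q y - sin (xi * y) * p y) +
  sin (x * xi) * integ (fun y => cos (xi * y) * p y + sin (xi * y) * q y) =
  cos_transform q 0 x xi + cos_transform p (- (pi / 2)) x xi.
Proof.
move=> ip iq.
have ic f : itg f -> itg (fun y => cos (xi * y) * f y).
  by move=> h; apply: itg_eq (itg_cosM xi 0 h) => y; rewrite addr0.
have isn f : itg f -> itg (fun y => sin (xi * y) * f y).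
  by move=> h; apply: itg_eq (itg_sinM xi 0 h) => y; rewrite addr0.
have i1 := itgD (ic _ ip) (isn _ iq); have i2 := itgB (ic _ iq) (isn _ ip).
rewrite -(integZ _ i1) -(integZ _ i2) -(integD (itgZ _ i2) (itgZ _ i1)).
rewrite -(integD (itg_cos_kernel _ _ _ iq) (itg_cos_kernel _ _ _ ip)).
apply: integ_eq => y; rewrite addr0 (_ : xi * (x - y) = x * xi - xi * y); last by ring.
rewrite [cos (_ - pi / 2)]cosB cos_pihalf sin_pihalf mulr0 mulr1 add0r cosB sinB.
by ring.
Qed.

(* The sine part of the multiplier integral vanishes because [symb] is even. *)
Lemma integ_symb_sin p x : testR p ->
  integ (fun xi => symb alpha xi * cos_transform p (- (pi / 2)) x xi) = 0.
Proof.
move=> tp; have i := itg_symb_cos_transform alpha_lt1 (- (pi / 2)) x tp.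
have ip : itg p := schwartz_itg (test_schwartz tp) 0.
have E : integ (fun xi => symb alpha xi * cos_transform p (- (pi / 2)) x xi) =
    -1 * integ (fun xi => symb alpha xi * cos_transform p (- (pi / 2)) x xi).
  rewrite {1}(integ_opp i) -(integZ (-1) i); apply: integ_eq => xi.
  rewrite /symb sqrrN mulrCA; congr (_ * _).
  rewrite -(integZ (-1) (itg_cos_kernel (- (pi / 2)) x xi ip)); apply: integ_eq => y.
  rewrite !cosB cos_pihalf sin_pihalf !mulr0 !mulr1 !add0r mulNr sinN; ring.
by lra.
Qed.

(** The two normalisations give 1 / (2 pi), cancelling the factor of [symb_multiplier]. The sine
    terms vanish, so real and imaginary parts do not mix. *)
Lemma Atrans_levy (phi : R -> C) x : test_pos phi -> Atrans alpha phi x =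
  cmk (levy m (fun x => cre (phi x)) x) (levy m (fun x => cim (phi x)) x).
Proof.
move=> tphi; have tp := test_cre tphi; have tq := test_cim tphi.
have ip : itg (fun x => cre (phi x)) := schwartz_itg (test_schwartz tp) 0.
have iq : itg (fun x => cim (phi x)) := schwartz_itg (test_schwartz tq) 0.
have i th p : testR p -> itg (fun xi => symb alpha xi * cos_transform p th x xi).
  by move=> h; exact: itg_symb_cos_transform.
have pi0 : (2 * pi : R) != 0 by rewrite mulf_neq0// gt_eqF// pi_gt0.
apply: complex_ext.
- transitivity (root2pi_inv * integ (fun xi => root2pi_inv * (
    symb alpha xi * cos_transform (fun x => cre (phi x)) 0 x xi -
    symb alpha xi * cos_transform (fun x => cim (phi x)) (- (pi / 2)) x xi))).
    rewrite cre_cofRM; congr (_ * _); apply: integ_eq => xi.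
    rewrite creM cre_cofRM cim_cofRM cre_fourier_inv cim_fourier_inv /=.
    rewrite -mulrBr -(fourier_cross_re x xi ip iq); ring.
  rewrite (integZ _ (itgB (i _ _ tp) (i _ _ tq))) (integB (i _ _ tp) (i _ _ tq)).
  rewrite integ_symb_sin// subr0 mulrA root2pi_inv_sqr symb_multiplier//.
  by rewrite mulrA mulVf// mul1r.
- transitivity (root2pi_inv * integ (fun xi => root2pi_inv * (
    symb alpha xi * cos_transform (fun x => cim (phi x)) 0 x xi +
    symb alpha xi * cos_transform (fun x => cre (phi x)) (- (pi / 2)) x xi))).
    rewrite cim_cofRM; congr (_ * _); apply: integ_eq => xi.
    rewrite cimM cre_cofRM cim_cofRM cre_fourier_inv cim_fourier_inv /=.
    rewrite -mulrDr -(fourier_cross_im x xi ip iq); ring.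
  rewrite (integZ _ (itgD (i _ _ tq) (i _ _ tp))) (integD (i _ _ tq) (i _ _ tp)).
  rewrite integ_symb_sin// addr0 mulrA root2pi_inv_sqr symb_multiplier//.
  by rewrite mulrA mulVf// mul1r.
Qed.

Lemma integ_support_pos (f : R -> R) : (forall x, x <= 0 -> f x = 0) ->
  Rintegral (@lebesgue_measure R) `]0, +oo[ f = integ f.
Proof.
move=> f0; rewrite -integ_halfline; apply: integ_eq => x.
by case: ltP => // /f0 ->.
Qed.

(** The complex pairing of f with the transpose applied to phi expands into four real ones, each
    transposed by [levy_duality]; [levy_continuous] gives the continuity that [rplusA] asks of a
    representative. *)
Lemma rplusA_levy (f : R -> C) :
  tame (fun x => cre (f x)) -> tame (fun x => cim (f x)) ->
  rplusA alpha f (fun x => cmk (levy m (fun x => cre (f x)) x) (levy m (fun x => cim (f x)) x)).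
Proof.
have m0 := mker_ge0 alpha_gt0 alpha_lt1; have mn := @mker_le0 R alpha.
have mm := measurable_mker alpha; have im2 := itg_sqr_mker alpha_gt0 alpha_lt1.
move=> tf1 tf2; split=> [x x0|phi tphi].
  by split; apply: levy_continuous.
have tp := test_cre tphi; have tq := test_cim tphi.
have [_ [_ [a [b [a0 h]]]]] := tphi.
have z x : x <= 0 -> phi x = 0 by move=> x0; apply: h; left; exact: le_lt_trans a0.
have [i1 j1 e1] := levy_duality m0 mn mm im2 tf1 tp.
have [i2 j2 e2] := levy_duality m0 mn mm im2 tf2 tq.
have [i3 j3 e3] := levy_duality m0 mn mm im2 tf1 tq.
have [i4 j4 e4] := levy_duality m0 mn mm im2 tf2 tp.
apply: complex_ext.
- rewrite !cre_Cint integ_support_pos; last by move=> x /z ->; rewrite mulr0.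
  transitivity (integ (fun x => levy m (fun x => cre (f x)) x * cre (phi x) -
      levy m (fun x => cim (f x)) x * cim (phi x))).
    by apply: integ_eq => x; rewrite creM.
  rewrite (integB j1 j2) -e1 -e2 -(integB i1 i2); apply: integ_eq => x.
  by rewrite creM Atrans_levy.
- rewrite !cim_Cint integ_support_pos; last by move=> x /z ->; rewrite mulr0.
  transitivity (integ (fun x => levy m (fun x => cre (f x)) x * cim (phi x) +
      levy m (fun x => cim (f x)) x * cre (phi x))).
    by apply: integ_eq => x; rewrite cimM.
  rewrite (integD j3 j4) -e3 -e4 -(integD i3 i4); apply: integ_eq => x.
  by rewrite cimM Atrans_levy.
Qed.

End Transpose.

(** * The pairing with u and the assembly of the theorem *)

Lemma tame_zero (R : realType) : tame (fun=> 0 : R).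
Proof.
apply: (@tame_half R _ (fun=> 0) 0 0) => //.
- by move=> x; rewrite normr0.
- by move=> x; exact: cvg_cst.
- by move=> x w _; rewrite /diff2 mulr0 !subr0 normr0 mul0r.
- by move=> x _; exact: cvg_cst.
Qed.

Lemma levy_zero (R : realType) (m : R -> R) x : levy m (fun=> 0) x = 0.
Proof.
rewrite /levy add0r (integ_eq (g := fun=> 0)) ?integ0// => w.
by rewrite /diff2 mulr0 !subr0 mul0r.
Qed.

Section HalfLineForm.
Variables (R : realType) (m : R -> R) (p q : R -> R).
Hypotheses (m_ge0 : forall w, 0 <= m w) (m_le0 : forall w, w <= 0 -> m w = 0).
Hypotheses (mm : measurable_fun setT m) (im2 : itg (fun w => w ^+ 2 * m w)).
Hypotheses (sp : schwartzR p) (sq : schwartzR q).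

Let Q (f : R -> R) x := integ (fun w => pv_diff f x w * m w).

Lemma itg_schwartzM : itg (fun x => if 0 < x then p x * q x else 0).
Proof.
have ip : itg p := schwartz_itg sp 0; have iq : itg q := schwartz_itg sq 0.
have mp := itg_mf ip; have mq := itg_mf iq.
have [B B0 hB] := schwartz_bounded sp 0.
have ipq : itg (fun x => p x * q x) by exact: itgM_bounded iq.
apply: (itg_le _ _ (integrable_abse ipq)); first by meas.
by move=> x; case: ifP => // _; rewrite normr0.
Qed.

Lemma half_form :
  itg (fun x => if 0 < x then (p x + Q p x) * q x else 0) /\
  integ (fun x => if 0 < x then (p x + Q p x) * q x else 0) =
  integ (fun x => if 0 < x then p x * q x else 0) + integ2 (form_density m p q).
Proof.
have [i1 e1] := energy_form m_ge0 m_le0 mm im2 sp sq.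
have E : (fun x => if 0 < x then (p x + Q p x) * q x else 0) =
  (fun x => (if 0 < x then p x * q x else 0) + (if 0 < x then Q p x * q x else 0)).
  by apply/funext => x; case: ifP => _; rewrite ?mulrDl ?addr0.
by rewrite E integD ?e1//; [split=> //; apply: itgD => //|]; exact: itg_schwartzM.
Qed.

End HalfLineForm.

(** This makes (Au, u) real: it equates the forms of (q, p) and (p, q), whose difference enters the
    imaginary part. *)
Lemma form_density_sym (R : realType) (m p q : R -> R) : form_density m p q = form_density m q p.
Proof.
apply/funext => x; apply/funext => w; rewrite /form_density.
by case: ifP => // _; ring.
Qed.

Theorem theorem2p1 (R : realType) (alpha : R) (v : R -> complex R) :
  0 < alpha -> alpha < 1 -> schwartz v ->
  exists m : R -> R,
    (exists (M delta : R), 0 < delta /\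
       forall w : R, 0 < w -> w < delta -> `|m w| <= M * powR w (- 1 - 2 * alpha)) /\
    (exists (M K : R), forall w : R, K < w -> `|m w| <= M * expR (- w)) /\
    exists g1 g2 : R -> complex R,
      rplusA alpha (eplus v) g1 /\ rplusA alpha (@chi_neg R) g2 /\
      (* (A u)(x) = r_+ A e_+ u (x) + u(x) r_+ A chi_- (x), u = r_+ v *)
      let Au := fun x => g1 x + v x * g2 x in
      (forall x : R, 0 < x ->
         (forall eps : R, 0 < eps ->
            Cintegrable `]0, +oo[
              (fun y => (v x - v y) * cofR (chi_eps eps `|x - y| * m `|x - y|))) /\
         cre (Cint `]0, +oo[
              (fun y => (v x - v y) * cofR (chi_eps eps `|x - y| * m `|x - y|)))
            @[eps --> 0^'+] --> cre (Au x - v x) /\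
         cim (Cint `]0, +oo[
              (fun y => (v x - v y) * cofR (chi_eps eps `|x - y| * m `|x - y|)))
            @[eps --> 0^'+] --> cim (Au x - v x)) /\
      Cintegrable `]0, +oo[ (fun x => Au x * cconj (v x)) /\
      ((@lebesgue_measure R) \x (@lebesgue_measure R))%E.-integrable
         (`]0, +oo[ `*` `]0, +oo[)
         (fun p => (csqnorm (v p.1 - v p.2) * m `|p.1 - p.2|)%:E) /\
      Cint `]0, +oo[ (fun x => Au x * cconj (v x)) =
        cofR (Rintegral (@lebesgue_measure R) `]0, +oo[ (fun x => csqnorm (v x))
              + 2^-1 * Rintegral (@lebesgue_measure R) `]0, +oo[ (fun x =>
                    Rintegral (@lebesgue_measure R) `]0, +oo[ (fun y =>
                       csqnorm (v x - v y) * m `|x - y|))).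
Proof.
move=> a0 a1 [sp sq]; exists (mker alpha).
have m0 := mker_ge0 a0 a1; have mn := @mker_le0 R alpha.
have mm := measurable_mker alpha; have im2 := itg_sqr_mker a0 a1.
set m := mker alpha in m0 mn mm im2 *.
set p := (fun x => cre (v x)) in sp; set q := (fun x => cim (v x)) in sq.
split.
  have [M hM] := mker_small a0 a1; exists M, 1; split=> // w w0 _; exact: hM.
split.
  exists (expR 1 * mker alpha 1), 1 => w /ltW w1; exact: mker_large.
have re_eplus : (fun x => cre (eplus v x)) = half_cut p.
  by apply/funext => x; rewrite /eplus /half_cut; case: ifP.
have im_eplus : (fun x => cim (eplus v x)) = half_cut q.
  by apply/funext => x; rewrite /eplus /half_cut; case: ifP.
have re_neg : (fun x => cre (chi_neg x)) = @neg_ind R.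
  by apply/funext => x; rewrite /chi_neg /neg_ind; case: ifP.
have im_neg : (fun x : R => cim (chi_neg x)) = fun=> 0.
  by apply/funext => x; rewrite /chi_neg; case: ifP.
have h1 := @rplusA_levy R alpha a0 a1 (eplus v).
rewrite re_eplus im_eplus in h1; have {}h1 := h1 (tame_cut sp) (tame_cut sq).
have h2 := @rplusA_levy R alpha a0 a1 (@chi_neg R).
rewrite re_neg im_neg in h2; have {}h2 := h2 (tame_neg R) (tame_zero R).
set g1 := (fun x => cmk _ _) in h1; set g2 := (fun x => cmk _ _) in h2.
exists g1, g2; split; first exact: h1.
split; first exact: h2.
cbv zeta.
pose Q f x := integ (fun w => pv_diff f x w * m w).
have ReAu x : 0 < x -> cre (g1 x + v x * g2 x) = p x + Q p x.
  move=> x0; rewrite creD creM /= levy_zero mulr0 subr0.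
  exact: (levy_cut m0 mn mm im2 sp x0).
have ImAu x : 0 < x -> cim (g1 x + v x * g2 x) = q x + Q q x.
  move=> x0; rewrite cimD cimM /= levy_zero mulr0 add0r.
  exact: (levy_cut m0 mn mm im2 sq x0).
split.
  move=> x x0.
  have reE eps : (fun y => if 0 < y then cre ((v x - v y) * cofR (chi_eps eps `|x - y| * m `|x - y|)) else 0)
     = (fun y => (if 0 < y then p x - p y else 0) * (chi_eps eps `|x - y| * m `|x - y|)).
    apply/funext => y; case: ifP => _; last by rewrite mul0r.
    by rewrite mulrC cre_cofRM creB mulrC.
  have imE eps : (fun y => if 0 < y then cim ((v x - v y) * cofR (chi_eps eps `|x - y| * m `|x - y|)) else 0)
     = (fun y => (if 0 < y then q x - q y else 0) * (chi_eps eps `|x - y| * m `|x - y|)).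
    apply/funext => y; case: ifP => _; last by rewrite mul0r.
    by rewrite mulrC cim_cofRM cimB mulrC.
  split.
    move=> eps e0; split; apply/itg_halfline.
      by rewrite reE; exact: (pv_integral m0 mn mm im2 sp x0 e0).1.
    by rewrite imE; exact: (pv_integral m0 mn mm im2 sq x0 e0).1.
  split.
    rewrite creB ReAu// [X in _ --> X](_ : _ = Q p x); last by rewrite /p; ring.
    apply: cvg_trans (pv_limit m0 mn mm im2 sp x0); apply: near_eq_cvg.
    near=> eps; rewrite cre_Cint -integ_halfline reE.
    apply/esym; apply: (pv_integral m0 mn mm im2 sp x0 _).2.
    by near: eps; exact: nbhs_right_gt.
  rewrite cimB ImAu// [X in _ --> X](_ : _ = Q q x); last by rewrite /q; ring.
  apply: cvg_trans (pv_limit m0 mn mm im2 sq x0); apply: near_eq_cvg.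
  near=> eps; rewrite cim_Cint -integ_halfline imE.
  apply/esym; apply: (pv_integral m0 mn mm im2 sq x0 _).2.
  by near: eps; exact: nbhs_right_gt.
(* Multiplying Au by the conjugate of v gives the pairings (p, p) + (q, q) in the real part and (q,
   p) - (p, q) in the imaginary part. *)
have [ipp epp] := half_form m0 mn mm im2 sp sp.
have [iqq eqq] := half_form m0 mn mm im2 sq sq.
have [ipq epq] := half_form m0 mn mm im2 sp sq.
have [iqp eqp] := half_form m0 mn mm im2 sq sp.
have reAE : (fun x => if 0 < x then cre ((g1 x + v x * g2 x) * cconj (v x)) else 0) =
    (fun x => (if 0 < x then (p x + Q p x) * p x else 0) +
              (if 0 < x then (q x + Q q x) * q x else 0)).
  apply/funext => x; case: ifPn => x0; last by rewrite addr0.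
  by rewrite creM ReAu// ImAu//= mulrN opprK.
have imAE : (fun x => if 0 < x then cim ((g1 x + v x * g2 x) * cconj (v x)) else 0) =
    (fun x => (if 0 < x then (q x + Q q x) * p x else 0) -
              (if 0 < x then (p x + Q p x) * q x else 0)).
  apply/funext => x; case: ifPn => x0; last by rewrite subr0.
  by rewrite cimM ReAu// ImAu//= mulrN addrC.
split.
  split; apply/itg_halfline; first by rewrite reAE; exact: itgD.
  by rewrite imAE; exact: itgB.
pose F f x y := if (0 < x) && (0 < y) then (f x - f y) ^+ 2 * m `|x - y| else 0.
have [iFp eFp] := double_integral m0 mn mm im2 sp.
have [iFq eFq] := double_integral m0 mn mm im2 sq.
rewrite -/(F p) in iFp eFp; rewrite -/(F q) in iFq eFq.
have FE x y : F p x y + F q x y =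
    if (0 < x) && (0 < y) then csqnorm (v x - v y) * m `|x - y| else 0.
  rewrite /F; case: ifP => _; last by rewrite addr0.
  by rewrite /csqnorm creB cimB mulrDl.
split.
  apply/integrable_mkcond; first exact: measurableX.
  apply: (eq_integrable _ _ _ _ (itg2D iFp iFq)) => // -[x y] _.
  rewrite patchE /= FE.
  have -> : ((x, y) \in `]0, +oo[ `*` `]0, +oo[) = (0 < x) && (0 < y).
    by apply/idP/idP; rewrite inE /= !in_itv/= !andbT => /andP.
  by case: ifP.
apply: complex_ext => /=.
- rewrite -!integ_halfline reAE (integD ipp iqq) epp eqq.
  have -> : integ (fun x => if 0 < x then csqnorm (v x) else 0) =
      integ (fun x => if 0 < x then p x * p x else 0) + integ (fun x => if 0 < x then q x * q x else 0).
    rewrite -(integD (itg_schwartzM sp sp) (itg_schwartzM sq sq)); apply: integ_eq => x.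
    by case: ifP => _; [rewrite /csqnorm !expr2|rewrite addr0].
  have -> : integ (fun x => if 0 < x then Rintegral (@lebesgue_measure R) `]0, +oo[ (fun y =>
      csqnorm (v x - v y) * m `|x - y|) else 0) = integ2 (fun x y => F p x y + F q x y).
    rewrite -(integ2E (itg2D iFp iFq)); apply: integ_eq => x.
    case: ifPn => x0.
      rewrite -integ_halfline; apply: integ_eq => y; rewrite FE x0 /=.
      by case: ifP.
    rewrite (integ_eq (g := fun=> 0)) ?integ0// => y.
    by rewrite FE (negbTE x0).
  (* The 2 of [double_integral], from the two orders of x and y, cancels the factor 1/2 of the
     statement. *)
  by rewrite (integ2D iFp iFq) eFp eFq; field.
- rewrite -!integ_halfline imAE (integB iqp ipq) eqp epq form_density_sym.
  rewrite (integ_eq (f := fun x => if 0 < x then q x * p x else 0)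
    (g := fun x => if 0 < x then p x * q x else 0)) ?subrr// => x.
  by case: ifP => // _; rewrite mulrC.
Unshelve. all: by end_near. Qed.
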